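(* Let $n\ge3$ be an integer and let $D$ be the interior of a regular $n$-gon in the hyperbolic plane $\mathbb{H}^2$ with side lengths $L>0$. If $F\colon D\to\mathbb{R}$ is a $\theta$-barrier for $D$, then $\theta\ge\frac{L}{32\log(n)}-\frac18$.
   Context: $\mathbb{H}^2$ is the hyperbolic plane: the complete simply connected Riemannian 2-manifold of constant sectional curvature $-1$, with metric $\langle\cdot,\cdot\rangle$ and distance $d$. $\log$ is the natural logarithm. A regular $n$-gon is the geodesically convex polygon whose vertices $p_1,\dots,p_n$ form the orbit of a point under the rotations by multiples of $2\pi/n$ about a center $c$; its side length is the distance between consecutive vertices. A set $D\subseteq \mathbb{H}^2$ is geodesically convex (g-convex) if for all $p,q\in D$ the geodesic segment from $p$ to $q$ lies in $D$. Barriers. Let $D\subseteq\mathbb{H}^2$ be open and g-convex. For a three times continuously differentiable $F\colon D\to\mathbb{R}$, let $\nabla F(p)\in T_p\mathbb{H}^2$ be the Riemannian gradient, $(\nabla^2F)_p$ the Riemannian Hessian (a symmetric bilinear form on $T_p\mathbb{H}^2$), and $(\nabla^3F)_p$ the third covariant derivative, i.e. the covariant derivative of the Hessian (a trilinear form, in general not symmetric). $F$ is strongly $1$-self-concordant if for all $p\in D$ and $u,v,w\in T_p\mathbb{H}^2$, $$|(\nabla^3F)_p(u,v,w)|\le 2\sqrt{(\nabla^2F)_p(u,u)}\sqrt{(\nabla^2F)_p(v,v)}\sqrt{(\nabla^2F)_p(w,w)},$$ and the epigraph $\{(p,t): p\in D,\ t\ge F(p)\}$ is a closed subset of $\mathbb{H}^2\times\mathbb{R}$.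 For a finite real number $\theta\ge 0$, $F$ is a $\theta$-barrier for $D$ if it is strongly $1$-self-concordant, $(\nabla^2F)_p\succ0$ for all $p\in D$, and $\max_{0\neq v\in T_p\mathbb{H}^2}\frac{\langle\nabla F(p),v\rangle}{\sqrt{(\nabla^2F)_p(v,v)}}\le\sqrt\theta$ for all $p\in D$. *)

(* Defs.v *)
From Stdlib Require Import Reals Lra.
From Coquelicot Require Import Coquelicot.

Open Scope R_scope.

(** The hyperbolic plane is the upper half-plane [{(x,y) | y > 0}] with the
    metric [(dx^2 + dy^2) / y^2].  It is covered by a single chart, so each
    tangent space is [R * R], the topology is that of [R * R], and the
    Riemannian notions are given by their expressions in coordinates, all
    derived from the metric coefficients [g]. *)

Inductive idx := i1 | i2.

Definition coord (v : R * R) (i : idx) : R :=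
  match i with i1 => fst v | i2 => snd v end.

Definition sum2 (f : idx -> R) : R := f i1 + f i2.

Definition vec (f : idx -> R) : R * R := (f i1, f i2).

(** The restriction of [f] to the line through [p] parallel to the [i]-th axis,
    as a function of the [i]-th coordinate. *)
Definition slice (i : idx) (f : R * R -> R) (p : R * R) : R -> R :=
  match i with
  | i1 => fun x => f (x, snd p)
  | i2 => fun y => f (fst p, y)
  end.

Definition pd (i : idx) (f : R * R -> R) (p : R * R) : R :=
  Derive (slice i f p) (coord p i).

Definition ex_pd (i : idx) (f : R * R -> R) (p : R * R) : Prop :=
  ex_derive (slice i f p) (coord p i).

(** [k]-times continuous differentiability on an open set [D].  Functions on
    [D] are total functions whose values outside [D] are irrelevant. *)
Fixpoint Ck (k : nat) (D : R * R -> Prop) (f : R * R -> R) : Prop :=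
  (forall p, D p -> continuous f p) /\
  match k with
  | O => True
  | S k' => forall i, (forall p, D p -> ex_pd i f p) /\ Ck k' D (pd i f)
  end.

Definition half_plane (p : R * R) : Prop := 0 < snd p.

Definition g (i j : idx) (p : R * R) : R :=
  match i, j with
  | i1, i1 | i2, i2 => / (snd p) ^ 2
  | _, _ => 0
  end.

Definition g_inv (i j : idx) (p : R * R) : R :=
  match i, j with
  | i1, i1 | i2, i2 => (snd p) ^ 2
  | _, _ => 0
  end.

Lemma g_invP (p : R * R) (i j : idx) : half_plane p ->
  sum2 (fun k => g_inv i k p * g k j p) =
  match i, j with i1, i1 | i2, i2 => 1 | _, _ => 0 end.
Proof.
unfold half_plane, sum2, g, g_inv; intros Hp.
destruct i, j; field; lra.
Qed.

Definition inner (p u v : R * R) : R :=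
  sum2 (fun i => sum2 (fun j => g i j p * coord u i * coord v j)).

(** Christoffel symbols [Gamma^k_ij] of the Levi-Civita connection. *)
Definition christoffel (k i j : idx) (p : R * R) : R :=
  / 2 * sum2 (fun l =>
    g_inv k l p * (pd i (g j l) p + pd j (g i l) p - pd l (g i j) p)).

Definition grad (F : R * R -> R) (p : R * R) : R * R :=
  vec (fun i => sum2 (fun j => g_inv i j p * pd j F p)).

Definition hess_coef (F : R * R -> R) (i j : idx) (p : R * R) : R :=
  pd i (pd j F) p - sum2 (fun k => christoffel k i j p * pd k F p).

Definition hess (F : R * R -> R) (p u v : R * R) : R :=
  sum2 (fun i => sum2 (fun j => hess_coef F i j p * coord u i * coord v j)).

(** The covariant derivative of the Hessian; the last index is the direction
    of differentiation. *)
Definition third_coef (F : R * R -> R) (i j k : idx) (p : R * R) : R :=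
  pd k (hess_coef F i j) p
  - sum2 (fun l => christoffel l k i p * hess_coef F l j p)
  - sum2 (fun l => christoffel l k j p * hess_coef F i l p).

Definition third (F : R * R -> R) (p u v w : R * R) : R :=
  sum2 (fun i => sum2 (fun j => sum2 (fun k =>
    third_coef F i j k p * coord u i * coord v j * coord w k))).

Definition crd (c : R -> R * R) (k : idx) (t : R) : R := coord (c t) k.

Definition velocity (c : R -> R * R) (t : R) : R * R :=
  vec (fun k => Derive (crd c k) t).

(** Curves parametrized on [[0,1]]; they are defined on [R] so that derivatives
    at the endpoints are two-sided, which does not change the infimum below. *)
Definition C1_curve (c : R -> R * R) (p q : R * R) : Prop :=
  c 0 = p /\ c 1 = q /\
  forall t, 0 <= t <= 1 ->
    half_plane (c t) /\
    forall k, ex_derive (crd c k) t /\ continuous (Derive (crd c k)) t.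

Definition curve_length (c : R -> R * R) : R :=
  RInt (fun t => sqrt (inner (c t) (velocity c t) (velocity c t))) 0 1.

Definition hdist (p q : R * R) : R :=
  real (Glb_Rbar (fun l => exists c, C1_curve c p q /\ l = curve_length c)).

(** Constant-speed geodesics.  The hyperbolic plane is complete, so every
    geodesic is a restriction of one defined on all of [R]. *)
Definition geodesic (c : R -> R * R) : Prop :=
  forall t, half_plane (c t) /\
    forall k,
      ex_derive (crd c k) t /\ ex_derive (Derive (crd c k)) t /\
      Derive (Derive (crd c k)) t
      + sum2 (fun i => sum2 (fun j =>
          christoffel k i j (c t) * Derive (crd c i) t * Derive (crd c j) t))
      = 0.

Definition segment (p q z : R * R) : Prop :=
  exists c, geodesic c /\ c 0 = p /\ c 1 = q /\
    exists t, 0 <= t <= 1 /\ z = c t.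

Definition g_convex (D : R * R -> Prop) : Prop :=
  forall p q z, D p -> D q -> segment p q z -> D z.

Definition g_hull (V : R * R -> Prop) (z : R * R) : Prop :=
  forall C, (forall p, C p -> half_plane p) -> g_convex C ->
    (forall p, V p -> C p) -> C z.

Definition h_interior (A : R * R -> Prop) (p : R * R) : Prop := locally p A.

(** [q] is the image of the tangent vector [v] under the exponential map
    at [p]. *)
Definition is_exp (p v q : R * R) : Prop :=
  exists c, geodesic c /\ c 0 = p /\ velocity c 0 = v /\ c 1 = q.

(** The metric is conformal to the Euclidean one, so this Euclidean rotation is
    also the rotation by [a] in every tangent space. *)
Definition rotate (a : R) (v : R * R) : R * R :=
  (cos a * fst v - sin a * snd v, sin a * fst v + cos a * snd v).

(** The rotation by [a] about [c] is the isometry fixing [c] whose differential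
    at [c] is [rotate a]; it commutes with the exponential map at [c] and
    sends [p] to [q]. *)
Definition is_rotation (c : R * R) (a : R) (p q : R * R) : Prop :=
  exists v, is_exp c v p /\ is_exp c (rotate a v) q.

(** [v k] is defined for every natural number [k] and is [n]-periodic, so that
    [v (n - 1)] and [v n = v 0] are consecutive. *)
Definition regular_polygon (n : nat) (L : R) (P : R * R -> Prop) : Prop :=
  exists (c : R * R) (v : nat -> R * R),
    half_plane c /\
    (forall k, is_rotation c (2 * PI * INR k / INR n) (v 0%nat) (v k)) /\
    (forall k, hdist (v k) (v (S k)) = L) /\
    (forall z, P z <-> g_hull (fun w => exists k, w = v k) z).

Definition epigraph
    (D : R * R -> Prop) (F : R * R -> R) (z : R * R * R) : Prop :=
  D (fst z) /\ F (fst z) <= snd z.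

(** Closedness relative to the product of the half-plane and [R]. *)
Definition closed_in_HxR (E : R * R * R -> Prop) : Prop :=
  forall z, half_plane (fst z) -> ~ locally z (fun y => ~ E y) -> E z.

Definition strongly_1_self_concordant
    (D : R * R -> Prop) (F : R * R -> R) : Prop :=
  (forall p u v w, D p ->
     Rabs (third F p u v w) <=
     2 * sqrt (hess F p u u) * sqrt (hess F p v v) * sqrt (hess F p w w)) /\
  closed_in_HxR (epigraph D F).

(** Intended for an open g-convex subset [D] of the half-plane. *)
Definition barrier (D : R * R -> Prop) (F : R * R -> R) (theta : R) : Prop :=
  0 <= theta /\
  Ck 3 D F /\
  strongly_1_self_concordant D F /\
  (forall p v, D p -> v <> (0, 0) -> 0 < hess F p v v) /\
  (forall p v, D p -> v <> (0, 0) ->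
     inner p (grad F p) v / sqrt (hess F p v v) <= sqrt theta).

(* Main.v *)
Require Import Defs.
From Stdlib Require Import Reals Arith Lra Lia Psatz.
From Coquelicot Require Import Coquelicot.

Open Scope R_scope.

(** Let [o] be the centre and [r >= L / 2] the circumradius of the polygon.
    Along a unit-speed geodesic, [f = F o c] satisfies [f'' = hess] and
    [f''' = third], so [/ sqrt f''] is 1-Lipschitz.  If the geodesic leaves [D]
    within time [l], then [f'' 0 >= / l ^ 2], since otherwise [f] would stay
    bounded and the epigraph would not be closed.  If [f' 0 >= 0] and the geodesic
    stays in [D] up to time [T], then [T * sqrt (f'' 0) <= 1 + 2 * theta]: from
    time [/ sqrt (f'' 0)] on, [f' >= sqrt (f'' 0) / 2] and [f'^2 <= theta f''],
    which makes [- theta / f' - t] nondecreasing.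

    From [o], the bisector of two consecutive vertex directions leaves the polygon
    within time [ln n], while a vertex direction stays in it up to time [r].  A
    bisector is opposite to a vertex direction when [n] is odd, and a
    combination of two vertex directions when [n] is even; so there is a vertex
    direction [u] with [<grad F, u> >= 0] and [hess u u >= / (2 ln n) ^ 2], and
    [r <= 2 ln n (1 + 2 theta)]. *)

(** * Geodesics and hyperboloid coordinates *)

(** Hyperboloid coordinates turn the geometry into linear algebra. Along a geodesic segment they are
    combinations of the endpoint values with nonnegative weights, so the segment is the radial
    projection of a straight chord and g-convex sets correspond to convex cones in dimension three.
    A point is put in the polygon by writing it as a positive combination of the vertices, and kept
    out of it by a linear form that is nonnegative at every vertex and negative at the point.

    The difficulty is that a single direction has to satisfy opposite demands: a large Hessian comes
    from an early exit, which a bisector provides, while the length estimate wants a late exit,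
    which a vertex direction provides. Since the Hessian is a nonnegative quadratic form, passing
    from a bisector to a vertex direction costs at most a factor 4, that is, a factor 2 in front of
    [ln n]. The exit time of the bisectors is bounded independently of [r], which is why the
    resulting bound on [theta] grows linearly in [r]. *)

Lemma pd_g (l i j : idx) (p : R * R) : half_plane p ->
  pd l (g i j) p =
  match l, i, j with
  | i2, i1, i1 | i2, i2, i2 => - 2 / snd p ^ 3
  | _, _, _ => 0
  end.
Proof.
unfold half_plane, pd, slice, coord, g; intros Hp.
destruct l, i, j; simpl; try (now apply Derive_const).
all: apply is_derive_unique; auto_derive; [nra | field; lra].
Qed.

Lemma christoffel_half_plane (k i j : idx) (p : R * R) : half_plane p ->
  christoffel k i j p =
  match k, i, j with
  | i1, i1, i2 | i1, i2, i1 | i2, i2, i2 => - / snd p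
  | i2, i1, i1 => / snd p
  | _, _, _ => 0
  end.
Proof.
intros Hp; unfold christoffel, sum2; rewrite !pd_g by assumption.
unfold half_plane in Hp; unfold g_inv.
destruct k, i, j; field; lra.
Qed.

Lemma geodesicE (c : R -> R * R) : geodesic c <->
  forall t, half_plane (c t) /\
    ex_derive (crd c i1) t /\ ex_derive (crd c i2) t /\
    is_derive (Derive (crd c i1)) t
      (2 * Derive (crd c i1) t * Derive (crd c i2) t / snd (c t)) /\
    is_derive (Derive (crd c i2)) t
      ((Derive (crd c i2) t ^ 2 - Derive (crd c i1) t ^ 2) / snd (c t)).
Proof.
split; intros H t; destruct (H t) as [Hp Ht]; split; auto.
- destruct (Ht i1) as [Hx [Hxx Ex]]; destruct (Ht i2) as [Hy [Hyy Ey]].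
  unfold sum2 in Ex, Ey; rewrite !christoffel_half_plane in Ex, Ey by assumption.
  unfold half_plane in Hp.
  split; [exact Hx | split; [exact Hy | split]].
  + evar_last; [now apply Derive_correct|].
    set (d := Derive (Derive (crd c i1)) t) in *.
    replace d with (d - 0) by ring; rewrite <- Ex; field; lra.
  + evar_last; [now apply Derive_correct|].
    set (d := Derive (Derive (crd c i2)) t) in *.
    replace d with (d - 0) by ring; rewrite <- Ey; field; lra.
- destruct Ht as [Hx [Hy [Hxx Hyy]]].
  intros k; unfold sum2; rewrite !christoffel_half_plane by assumption.
  unfold half_plane in Hp.
  destruct k; (split; [auto | split; [eexists; eauto |]]).
  + rewrite (is_derive_unique _ _ _ Hxx); field; lra.
  + rewrite (is_derive_unique _ _ _ Hyy); field; lra.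
Qed.

(** The linear forms in the hyperboloid coordinates
    [(1 / y, x / y, (x ^ 2 + y ^ 2) / y)]: along a geodesic of speed [k] they
    satisfy [h'' = k ^ 2 h]. *)
Definition hyp (a b d : R) (z : R * R) : R :=
  (a + b * fst z + d * (fst z ^ 2 + snd z ^ 2)) / snd z.

Definition dhyp (a b d : R) (z v : R * R) : R :=
  (b * fst v + 2 * d * (fst z * fst v + snd z * snd v)) / snd z
  - hyp a b d z * snd v / snd z.

Definition speed2 (c : R -> R * R) (t : R) : R :=
  inner (c t) (velocity c t) (velocity c t).

Lemma innerE (p u v : R * R) :
  half_plane p ->
  inner p u v = (fst u * fst v + snd u * snd v) / snd p ^ 2.
Proof.
unfold half_plane; intros H; unfold inner, sum2, g, coord; field; lra.
Qed.

Lemma is_derive_const_eq (f : R -> R) :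
  (forall t, is_derive f t 0) -> forall t, f t = f 0.
Proof.
intros H t.
destruct (MVT_gen f 0 t (fun _ => 0)) as [x [_ Hx]].
- intros; apply H.
- intros x _; apply continuity_pt_filterlim, (ex_derive_continuous f).
  exists 0; apply H.
- lra.
Qed.

Definition geodesic_eqs (x y dx dy : R -> R) (t : R) : Prop :=
  0 < y t /\ is_derive x t (dx t) /\ is_derive y t (dy t) /\
  is_derive dx t (2 * dx t * dy t / y t) /\
  is_derive dy t ((dy t ^ 2 - dx t ^ 2) / y t).

Lemma geodesic_derives c : geodesic c -> forall t,
  geodesic_eqs (fun t => fst (c t)) (fun t => snd (c t))
    (fun t => fst (velocity c t)) (fun t => snd (velocity c t)) t.
Proof.
intros H t; destruct (proj1 (geodesicE c) H t) as [Hp [Hx [Hy [Hxx Hyy]]]].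
split; [exact Hp|].
split; [exact (Derive_correct _ _ Hx)|].
split; [exact (Derive_correct _ _ Hy)|].
split; [exact Hxx | exact Hyy].
Qed.

Ltac derive_along H :=
  let Hp := fresh in let Hx := fresh in let Hy := fresh in
  let Hxx := fresh in let Hyy := fresh in
  destruct H as [Hp [Hx [Hy [Hxx Hyy]]]]; auto_derive;
  [ repeat match goal with |- _ /\ _ => split end;
    try (eexists; eassumption); try exact I; nra
  | apply is_derive_unique in Hx, Hy, Hxx, Hyy;
    repeat match goal with |- context [Derive (fun x => ?f x)] =>
      change (fun x => f x) with f end;
    rewrite ?Hx, ?Hy, ?Hxx, ?Hyy; field; lra ].

Lemma speed_derive x y dx dy t : geodesic_eqs x y dx dy t ->
  is_derive (fun t => (dx t ^ 2 + dy t ^ 2) / y t ^ 2) t 0.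
Proof. intros H; derive_along H. Qed.

Lemma hyp_derive_aux a b d x y dx dy t : geodesic_eqs x y dx dy t ->
  is_derive (fun t => (a + b * x t + d * (x t ^ 2 + y t ^ 2)) / y t) t
    ((b * dx t + 2 * d * (x t * dx t + y t * dy t)) / y t
     - (a + b * x t + d * (x t ^ 2 + y t ^ 2)) / y t * dy t / y t).
Proof. intros H; derive_along H. Qed.

Lemma dhyp_derive_aux a b d x y dx dy t : geodesic_eqs x y dx dy t ->
  is_derive (fun t => (b * dx t + 2 * d * (x t * dx t + y t * dy t)) / y t
     - (a + b * x t + d * (x t ^ 2 + y t ^ 2)) / y t * dy t / y t) t
    ((dx t ^ 2 + dy t ^ 2) / y t ^ 2 *
     ((a + b * x t + d * (x t ^ 2 + y t ^ 2)) / y t)).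
Proof. intros H; derive_along H. Qed.

Lemma speed2E c t : half_plane (c t) ->
  speed2 c t =
  (fst (velocity c t) ^ 2 + snd (velocity c t) ^ 2) / snd (c t) ^ 2.
Proof.
intros H; unfold speed2; rewrite innerE by exact H.
unfold Rdiv; f_equal; ring.
Qed.

Lemma speed2_const c : geodesic c -> forall t, speed2 c t = speed2 c 0.
Proof.
intros H; apply is_derive_const_eq; intros t.
eapply is_derive_ext.
- intros s; symmetry; apply speed2E, H.
- exact (speed_derive _ _ _ _ _ (geodesic_derives c H t)).
Qed.

Lemma hyp_derive c a b d : geodesic c -> forall t,
  is_derive (fun t => hyp a b d (c t)) t (dhyp a b d (c t) (velocity c t)).
Proof.
intros H t.
exact (hyp_derive_aux a b d _ _ _ _ _ (geodesic_derives c H t)).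
Qed.

Lemma dhyp_derive c a b d : geodesic c -> forall t,
  is_derive (fun t => dhyp a b d (c t) (velocity c t)) t
    (speed2 c 0 * hyp a b d (c t)).
Proof.
intros H t; rewrite <- (speed2_const c H t), speed2E by apply H.
exact (dhyp_derive_aux a b d _ _ _ _ _ (geodesic_derives c H t)).
Qed.

Lemma exp_mul_opp x : exp x * exp (- x) = 1.
Proof. rewrite <- exp_plus, Rplus_opp_r; apply exp_0. Qed.

(** For [e = 1] and [e = -1] the quantity [(h1 + e k h) exp (- e k t)] is conserved; the formula is
    the difference of the two conservation laws. The factor [k] on the left avoids a division, so
    that [k = 0] is allowed. *)
Lemma hyperbolic_ode (k : R) (h h1 : R -> R) :
  (forall t, is_derive h t (h1 t)) ->
  (forall t, is_derive h1 t (k ^ 2 * h t)) ->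
  forall t, k * h t = k * h 0 * cosh (k * t) + h1 0 * sinh (k * t).
Proof.
intros H H1 t.
assert (A : forall e, e ^ 2 = 1 ->
  (h1 t + e * k * h t) * exp (- e * k * t) = h1 0 + e * k * h 0).
{ intros e He.
  rewrite (is_derive_const_eq (fun t => (h1 t + e * k * h t) * exp (- e * k * t))).
  - rewrite Rmult_0_r, exp_0; ring.
  - clear t; intros t; auto_derive.
    + repeat split; eexists; eauto.
    + change (fun x => h x) with h; change (fun x => h1 x) with h1.
      rewrite (is_derive_unique _ _ _ (H t)), (is_derive_unique _ _ _ (H1 t)).
      match goal with |- ?l = 0 => replace l with
        ((1 - e ^ 2) * k ^ 2 * h t * exp (- e * k * t)) by ring end.
      rewrite He; ring. }
assert (A1 := A 1 ltac:(ring)); assert (A2 := A (-1) ltac:(ring)).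
replace (- (1) * k * t) with (- (k * t)) in A1 by ring.
replace (- -1 * k * t) with (k * t) in A2 by ring.
assert (E := exp_mul_opp (k * t)).
unfold cosh, sinh.
transitivity (((h1 t + 1 * k * h t) * exp (- (k * t)) * exp (k * t)
  - (h1 t + -1 * k * h t) * exp (k * t) * exp (- (k * t))) / 2).
- rewrite !Rmult_assoc, (Rmult_comm (exp (- _))), E; field.
- rewrite A1, A2; field.
Qed.

(** The value 1 at 0 is the limit of the quotient; it lets constant geodesics share the formulas of
    the others. *)
Definition sinhc (k : R) : R := if Req_EM_T k 0 then 1 else sinh k / k.

Lemma sinhcE k : k * sinhc k = sinh k.
Proof.
unfold sinhc; destruct (Req_EM_T k 0) as [-> | Hk].
- rewrite sinh_0; ring.
- field; auto.
Qed.

Lemma speed2_ge0 c : geodesic c -> 0 <= speed2 c 0.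
Proof.
intros H; unfold speed2; rewrite innerE by apply H.
destruct (H 0) as [Hp _]; unfold half_plane in Hp.
apply Rmult_le_pos; [nra|]; left; apply Rinv_0_lt_compat; nra.
Qed.

Lemma geodesic_speed0 c : geodesic c -> speed2 c 0 = 0 ->
  forall t, velocity c t = (0, 0).
Proof.
intros H E t; rewrite <- (speed2_const c H t) in E.
destruct (H t) as [Hp _]; unfold half_plane in Hp.
unfold speed2 in E; rewrite innerE in E by apply H.
set (v := velocity c t) in *.
assert (Z : fst v * fst v + snd v * snd v = 0).
{ replace (fst v * fst v + snd v * snd v) with
    ((fst v * fst v + snd v * snd v) / snd (c t) ^ 2 * snd (c t) ^ 2)
    by (field; lra).
  rewrite E; ring. }
rewrite (surjective_pairing v); f_equal; nra.
Qed.

Lemma geodesic_hyp c a b d : geodesic c -> forall t,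
  hyp a b d (c t) = hyp a b d (c 0) * cosh (sqrt (speed2 c 0) * t)
    + dhyp a b d (c 0) (velocity c 0) * t * sinhc (sqrt (speed2 c 0) * t).
Proof.
intros H t.
assert (Hk := speed2_ge0 c H).
destruct (Req_dec (speed2 c 0) 0) as [E | E].
- rewrite (geodesic_speed0 c H E 0), E, sqrt_0, Rmult_0_l, cosh_0.
  replace (dhyp a b d (c 0) (0, 0)) with 0
    by (unfold dhyp; simpl; unfold Rdiv; ring).
  rewrite (is_derive_const_eq (fun t => hyp a b d (c t))); [ring|].
  intros s; evar_last; [apply (hyp_derive c a b d H)|].
  rewrite (geodesic_speed0 c H E s); unfold dhyp; simpl; unfold Rdiv; ring.
- set (k := sqrt (speed2 c 0)).
  assert (Hkp : 0 < k) by (apply sqrt_lt_R0; lra).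
  assert (K : k ^ 2 = speed2 c 0).
  { unfold k; simpl; rewrite Rmult_1_r; apply sqrt_sqrt; auto. }
  assert (O := hyperbolic_ode k (fun t => hyp a b d (c t))
    (fun t => dhyp a b d (c t) (velocity c t)) (hyp_derive c a b d H)).
  apply (Rmult_eq_reg_l k); [|lra].
  rewrite O; [|intros s; rewrite K; apply dhyp_derive; auto].
  rewrite <- sinhcE; ring.
Qed.

Lemma sinh_gt0 x : 0 < x -> 0 < sinh x.
Proof. intros H; rewrite <- sinh_0; now apply sinh_lt. Qed.

Lemma sinh_ge0 x : 0 <= x -> 0 <= sinh x.
Proof.
intros [H | <-]; [left; now apply sinh_gt0 | rewrite sinh_0; lra].
Qed.

Lemma cosh_gt0 x : 0 < cosh x.
Proof. unfold cosh; assert (H := exp_pos x); assert (H' := exp_pos (- x)); lra. Qed.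

Lemma cosh_sinh_sqr x : cosh x ^ 2 - sinh x ^ 2 = 1.
Proof.
unfold cosh, sinh.
assert (E := exp_mul_opp x).
rewrite <- E; field.
Qed.

Lemma sinh_minus x y : sinh (x - y) = sinh x * cosh y - cosh x * sinh y.
Proof.
unfold cosh, sinh, Rminus.
rewrite Ropp_plus_distr, Ropp_involutive, !exp_plus; field.
Qed.

(** The hyperbolic analogue of spherical linear interpolation: the weights of the endpoints are
    [sinh (k - k t) / sinh k] and [sinh (k t) / sinh k], and they do not depend on the linear
    form. *)
Lemma geodesic_hyp_interp c a b d t : geodesic c ->
  let k := sqrt (speed2 c 0) in
  sinh k * hyp a b d (c t) =
    sinh (k - k * t) * hyp a b d (c 0) + sinh (k * t) * hyp a b d (c 1).
Proof.
intros H k.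
assert (E1 := geodesic_hyp c a b d H 1); assert (Et := geodesic_hyp c a b d H t).
fold k in E1, Et.
destruct (Req_dec k 0) as [-> | Hk].
{ replace (0 - 0 * t) with 0 by ring; rewrite Rmult_0_l, sinh_0; ring. }
set (D := dhyp _ _ _ _ _) in *.
assert (S : forall s, D * s * sinhc (k * s) = D / k * sinh (k * s)).
{ intros s; rewrite <- sinhcE; field; auto. }
rewrite S in E1, Et; rewrite !Rmult_1_r in E1.
rewrite Et, E1, sinh_minus; ring.
Qed.

Lemma hyp_segment_ge0 p q z a b d : segment p q z ->
  0 <= hyp a b d p -> 0 <= hyp a b d q -> 0 <= hyp a b d z.
Proof.
intros [c [H [<- [<- [t [Ht ->]]]]]] H0 H1.
assert (K := geodesic_hyp_interp c a b d t H); simpl in K.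
set (k := sqrt _) in *.
destruct (sqrt_pos (speed2 c 0)) as [Hk | Hk]; fold k in Hk.
- assert (0 < sinh k) by now apply sinh_gt0.
  assert (0 <= sinh (k - k * t)) by (apply sinh_ge0; nra).
  assert (0 <= sinh (k * t)) by (apply sinh_ge0; nra).
  apply Rnot_lt_le; intros Hn; nra.
(* At speed 0 the interpolation formula reads [0 = 0]; the explicit solution is then affine in [t],
   which gives ordinary interpolation. *)
- assert (E1 := geodesic_hyp c a b d H 1); assert (Et := geodesic_hyp c a b d H t).
  fold k in E1, Et; rewrite <- Hk, Rmult_0_l in E1, Et.
  assert (S0 : sinhc 0 = 1) by (unfold sinhc; destruct (Req_EM_T 0 0); lra).
  rewrite cosh_0, S0 in *; nra.
Qed.

(** * Chords and cones over convex sets *)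

(** On a geodesic of speed [k], [1 / y] and [x / y] are combinations of [e^(kt)]
    and [e^(-kt)]; the condition [Hc] below is [x'^2 + y'^2 = k^2 y^2]. *)
Definition exp_curve (k a1 b1 a2 b2 t : R) : R * R :=
  let U := a1 * exp (k * t) + b1 * exp (- (k * t)) in
  ((a2 * exp (k * t) + b2 * exp (- (k * t))) / U, / U).

Section ExpCurve.
Variables k a1 b1 a2 b2 : R.
Hypothesis (Ha : 0 <= a1) (Hb : 0 <= b1) (Hab : 0 < a1 + b1).
Hypothesis (Hc : (a2 * b1 - b2 * a1) ^ 2 = a1 * b1).
Let U t := a1 * exp (k * t) + b1 * exp (- (k * t)).
Let c := exp_curve k a1 b1 a2 b2.

Lemma exp_curve_pos t : 0 < U t.
Proof.
unfold U; assert (H := exp_pos (k * t)); assert (H' := exp_pos (- (k * t))).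
destruct Ha as [Ha' | <-]; nra.
Qed.

Let dx t := 2 * k * (a2 * b1 - b2 * a1) / U t ^ 2.
Let dy t := - k * (a1 * exp (k * t) - b1 * exp (- (k * t))) / U t ^ 2.

Lemma exp_curve_dx t : is_derive (crd c i1) t (dx t).
Proof.
assert (HU := exp_curve_pos t); unfold U in HU.
unfold dx, crd, c, exp_curve, U; simpl; auto_derive; [lra|].
assert (E := exp_mul_opp (k * t)).
set (e := exp (k * t)) in *; set (f := exp (- (k * t))) in *.
apply Rminus_diag_uniq.
match goal with |- ?l - ?r = 0 =>
  replace (l - r) with (2 * k * (a2 * b1 - b2 * a1) * (e * f - 1)
    / (a1 * e + b1 * f) ^ 2) by (field; lra) end.
rewrite E; unfold Rdiv; ring.
Qed.

Lemma exp_curve_dy t : is_derive (crd c i2) t (dy t).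
Proof.
assert (HU := exp_curve_pos t); unfold U in HU.
unfold dy, crd, c, exp_curve, U; simpl; auto_derive; [lra|].
field; lra.
Qed.

Lemma exp_curve_velocity t : velocity c t = (dx t, dy t).
Proof.
unfold velocity, vec; f_equal; apply is_derive_unique.
- apply exp_curve_dx.
- apply exp_curve_dy.
Qed.

Lemma exp_curve_geodesic : geodesic c.
Proof.
apply geodesicE; intros t.
assert (HU := exp_curve_pos t).
assert (E := exp_mul_opp (k * t)).
split; [unfold half_plane; simpl; fold (U t); now apply Rinv_0_lt_compat|].
split; [eexists; apply exp_curve_dx|].
split; [eexists; apply exp_curve_dy|].
rewrite (is_derive_unique _ _ _ (exp_curve_dx t)).
rewrite (is_derive_unique _ _ _ (exp_curve_dy t)).
split.
- eapply is_derive_ext; [intros s; symmetry; apply is_derive_unique, exp_curve_dx|].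
  unfold dx, dy, c, exp_curve; simpl; fold (U t); unfold U in *; auto_derive; [nra|].
  field; lra.
- eapply is_derive_ext; [intros s; symmetry; apply is_derive_unique, exp_curve_dy|].
  unfold dx, dy, c, exp_curve; simpl; fold (U t); unfold U in *; auto_derive; [nra|].
  set (e := exp (k * t)) in *; set (f := exp (- (k * t))) in *.
  apply Rminus_diag_uniq.
  match goal with |- ?l - ?r = 0 =>
    replace (l - r) with (4 * k ^ 2 * ((a2 * b1 - b2 * a1) ^ 2 - a1 * b1 * (e * f))
     / (a1 * e + b1 * f) ^ 3) by (field; lra) end.
  rewrite E, Hc; unfold Rdiv; ring.
Qed.

Lemma exp_curve_speed : speed2 c 0 = k ^ 2.
Proof.
rewrite speed2E by apply exp_curve_geodesic.
rewrite exp_curve_velocity; unfold dx, dy, c, exp_curve, U; simpl.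
rewrite Rmult_0_r, Ropp_0, exp_0, !Rmult_1_r.
transitivity (k ^ 2 * (4 * (a2 * b1 - b2 * a1) ^ 2 + (a1 - b1) ^ 2) / (a1 + b1) ^ 2).
- field; lra.
- rewrite Hc; field; lra.
Qed.

End ExpCurve.

Lemma hdist_le_speed c k : geodesic c -> 0 <= k -> speed2 c 0 = k ^ 2 ->
  hdist (c 0) (c 1) <= k.
Proof.
intros H Hk E; unfold hdist.
match goal with |- real (Glb_Rbar ?A) <= _ => set (S := A) end.
assert (HS : S k).
{ exists c; split.
  - split; [reflexivity|]; split; [reflexivity|].
    intros t _; destruct (H t) as [Hp Ht]; split; [exact Hp|].
    intros i; destruct (Ht i) as [H1 [H2 _]]; split; [exact H1|].
    apply (ex_derive_continuous (Derive (crd c i))), H2.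
  - unfold curve_length.
    rewrite (RInt_ext _ (fun _ => k)).
    + rewrite RInt_const; unfold scal; simpl; unfold mult; simpl; ring.
    + intros t _; fold (speed2 c t); rewrite (speed2_const c H t), E.
      now apply sqrt_pow2. }
destruct (Glb_Rbar_correct S) as [Hlb _].
specialize (Hlb k HS).
(* For an infimum of minus infinity [real] returns 0, and [0 <= k] closes that case. *)
destruct (Glb_Rbar S); simpl in *; lra.
Qed.

Lemma hdist_refl p : half_plane p -> hdist p p <= 0.
Proof.
unfold half_plane; intros Hp.
set (c := exp_curve 0 0 (/ snd p) 0 (fst p / snd p)).
assert (0 < / snd p) by now apply Rinv_0_lt_compat.
assert (Hc : forall t, c t = p).
{ intros t; unfold c, exp_curve; rewrite !Rmult_0_l, Ropp_0, exp_0.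
  rewrite (surjective_pairing p) at 5; f_equal; field; lra. }
rewrite <- (Hc 0) at 1; rewrite <- (Hc 1).
apply hdist_le_speed; try lra.
- apply exp_curve_geodesic; lra || (simpl; ring).
- apply exp_curve_speed; lra || (simpl; ring).
Qed.

(** [2 cosh] of the distance from [p] to [q]. *)
Definition cosh2 (p q : R * R) : R :=
  ((fst p - fst q) ^ 2 + snd p ^ 2 + snd q ^ 2) / (snd p * snd q).

Lemma cosh_unbounded y : 1 < y -> exists d, 0 < d /\ cosh d = y.
Proof.
intros Hy; exists (ln (y + sqrt (y ^ 2 - 1))).
assert (H := sqrt_lt_R0 (y ^ 2 - 1) ltac:(nra)).
assert (S := sqrt_sqrt (y ^ 2 - 1) ltac:(nra)).
set (s := sqrt _) in *.
split; [rewrite <- ln_1; apply ln_increasing; lra|].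
unfold cosh; rewrite exp_Ropp, !exp_ln by lra.
replace (/ (y + s)) with (y - s); [field|].
apply (Rmult_eq_reg_l (y + s)); [|lra].
rewrite Rinv_r by lra; nra.
Qed.

Lemma chord p q : half_plane p -> half_plane q -> p <> q ->
  exists c d, geodesic c /\ c 0 = p /\ c 1 = q /\
    0 < d /\ speed2 c 0 = d ^ 2 /\ 2 * cosh d = cosh2 p q.
Proof.
unfold half_plane; destruct p as [x y], q as [x' y']; simpl; intros Hy Hy' Hn.
assert (Hyy : 0 < y * y') by now apply Rmult_lt_0_compat.
assert (Hc : 2 < cosh2 (x, y) (x', y')).
{ unfold cosh2; simpl; apply Rlt_div_r; [lra|].
  assert (0 < (x - x') ^ 2 + (y - y') ^ 2); [|nra].
  assert (Hx := pow2_ge_0 (x - x')); assert (Hy2 := pow2_ge_0 (y - y')).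
  destruct (Req_dec x x') as [<- | N]; [|assert (K := pow2_gt_0 (x - x') ltac:(lra)); lra].
  destruct (Req_dec y y') as [<- | N]; [now elim Hn|].
  assert (K := pow2_gt_0 (y - y') ltac:(lra)); lra. }
destruct (cosh_unbounded (cosh2 (x, y) (x', y') / 2)) as [d [Hd E]]; [lra|].
assert (He := exp_mul_opp d).
assert (Hs : 0 < sinh d) by now apply sinh_gt0.
unfold cosh in E; unfold sinh in Hs.
assert (Er : (exp d + exp (- d)) * (y * y') = (x - x') ^ 2 + y ^ 2 + y' ^ 2).
{ replace (exp d + exp (- d)) with (cosh2 (x, y) (x', y')) by lra.
  unfold cosh2; simpl; field; lra. }
set (r := exp d) in *; set (s := exp (- d)) in *.
(* The coefficients solve the linear equations that fix [1 / y] and [x / y] at the times 0 and 1.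
   The constraint [Hcst] that makes the curve a geodesic then amounts to the choice of [d] through
   [cosh2]. *)
set (a1 := (/ y' - s / y) / (r - s)); set (b1 := (r / y - / y') / (r - s)).
set (a2 := (x' / y' - s * x / y) / (r - s)).
set (b2 := (r * x / y - x' / y') / (r - s)).
assert (Hab : a1 + b1 = / y) by (unfold a1, b1; field; lra).
assert (Hab' : a2 + b2 = x / y) by (unfold a2, b2; field; lra).
assert (Hab1 : a1 * r + b1 * s = / y') by (unfold a1, b1; field; lra).
assert (Hab1' : a2 * r + b2 * s = x' / y') by (unfold a2, b2; field; lra).
assert (Hinv : 0 < / y) by now apply Rinv_0_lt_compat.
assert (Hcst : (a2 * b1 - b2 * a1) ^ 2 = a1 * b1).
{ replace (a2 * b1 - b2 * a1) with ((x' - x) / (y * y') / (r - s))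
    by (unfold a1, b1, a2, b2; field; lra).
  replace (a1 * b1) with (((r + s) * (y * y') - y ^ 2 - r * s * y' ^ 2)
    / (y * y' * (r - s)) ^ 2) by (unfold a1, b1; field; lra).
  rewrite Er, He; field; lra. }
assert (Hprod : 0 <= a1 * b1) by (rewrite <- Hcst; apply pow2_ge_0).
assert (Ha1 : 0 <= a1) by nra.
assert (Hb1 : 0 <= b1) by nra.
assert (Hsum : 0 < a1 + b1) by lra.
exists (exp_curve d a1 b1 a2 b2), d.
split; [now apply exp_curve_geodesic|].
split.
{ unfold exp_curve; rewrite Rmult_0_r, Ropp_0, exp_0, !Rmult_1_r, Hab, Hab'.
  f_equal; field; lra. }
split.
{ unfold exp_curve; rewrite Rmult_1_r; fold r s; rewrite Hab1, Hab1'.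
  f_equal; field; lra. }
split; [exact Hd|].
split; [now apply exp_curve_speed|].
unfold cosh; fold r s; lra.
Qed.

Lemma cosh_le_inv x y : 0 <= x -> 0 <= y -> cosh x <= cosh y -> x <= y.
Proof.
intros Hx Hy H; apply Rnot_lt_le; intros Hyx.
assert (Hs := sinh_lt y x Hyx); assert (H0 := sinh_ge0 y Hy).
assert (E1 := cosh_sinh_sqr x); assert (E2 := cosh_sinh_sqr y).
assert (P := cosh_gt0 x); nra.
Qed.

Lemma hdist_le p q d : half_plane p -> half_plane q -> 0 <= d ->
  cosh2 p q <= 2 * cosh d -> hdist p q <= d.
Proof.
intros Hp Hq Hd H.
assert (Hpq : p = q \/ p <> q).
{ destruct p as [x y], q as [x' y'].
  destruct (Req_dec x x') as [-> |]; [|right; congruence].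
  destruct (Req_dec y y') as [-> |]; [now left | right; congruence]. }
destruct Hpq as [<- | Hpq].
- assert (T := hdist_refl p Hp); lra.
- destruct (chord p q Hp Hq Hpq) as [c [d' [Hc [<- [<- [Hd' [Hs E]]]]]]].
  apply Rle_trans with d'.
  + apply hdist_le_speed; auto; lra.
  + apply cosh_le_inv; lra.
Qed.

Lemma sinh_ratio d l m : 0 < d -> 0 < l -> 0 < m ->
  exists s, 0 < s < d /\ m * sinh (d - s) = l * sinh s.
Proof.
intros Hd Hl Hm.
assert (S := sinh_gt0 d Hd).
destruct (IVT (fun s => l * sinh s - m * sinh (d - s)) 0 d) as [s [Hs E]].
- intros x; apply continuity_pt_filterlim.
  apply (ex_derive_continuous (fun s => l * sinh s - m * sinh (d - s))).
  unfold sinh; auto_derive; auto.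
- exact Hd.
- rewrite sinh_0, Rminus_0_r; nra.
- rewrite Rminus_diag, sinh_0; nra.
- exists s; split; [|lra].
  split; apply Rnot_le_lt; intros Hn.
  + replace s with 0 in E by lra; rewrite sinh_0, Rminus_0_r in E; nra.
  + replace s with d in E by lra; rewrite Rminus_diag, sinh_0 in E; nra.
Qed.

(** The interpolation weights run through all positive ratios along the segment, so [sinh_ratio]
    finds the point where they are in the ratio [l : m]. This is what makes cones over g-convex sets
    closed under addition. *)
Lemma segment_combination p q l m : half_plane p -> half_plane q ->
  0 < l -> 0 < m ->
  (p = q \/ exists z r, segment p q z /\ 0 < r /\
    forall a b d, l * hyp a b d p + m * hyp a b d q = r * hyp a b d z).
Proof.
intros Hp Hq Hl Hm.
assert (Hpq : p = q \/ p <> q).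
{ destruct p as [x y], q as [x' y'].
  destruct (Req_dec x x') as [-> |]; [|right; congruence].
  destruct (Req_dec y y') as [-> |]; [now left | right; congruence]. }
destruct Hpq as [H | Hpq]; [now left|right].
destruct (chord p q Hp Hq Hpq) as [c [k [Hc [E0 [E1 [Hk [Hs _]]]]]]].
destruct (sinh_ratio k l m Hk Hl Hm) as [s [[Hs0 Hs1] E]].
assert (P1 := sinh_gt0 (k - s) ltac:(lra)); assert (P2 := sinh_gt0 s Hs0).
assert (P3 := sinh_gt0 k Hk).
exists (c (s / k)), (l * sinh k / sinh (k - s)); split.
- exists c; split; [exact Hc|]; split; [exact E0|]; split; [exact E1|].
  exists (s / k); split; [|reflexivity]; split.
  + apply Rdiv_le_0_compat; lra.
  + apply Rle_div_l; lra.
- split; [apply Rdiv_lt_0_compat; nra|].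
  intros a b d.
  assert (K := geodesic_hyp_interp c a b d (s / k) Hc); simpl in K.
  rewrite Hs in K; rewrite sqrt_pow2 in K by lra.
  replace (k * (s / k)) with s in K by (field; lra).
  rewrite E0, E1 in K.
  replace (l * sinh k / sinh (k - s) * hyp a b d (c (s / k)))
    with (l * (sinh k * hyp a b d (c (s / k))) / sinh (k - s)) by (field; lra).
  rewrite K.
  replace (l * (sinh (k - s) * hyp a b d p + sinh s * hyp a b d q) / sinh (k - s))
    with (l * hyp a b d p + l * sinh s * hyp a b d q / sinh (k - s)) by (field; lra).
  rewrite <- E; field; lra.
Qed.

(** The open cone over [P] in the ambient space of the hyperboloid. A vector is encoded by its
    values [Y a b d] on all linear forms, so that adding vectors is adding functions. *)
Definition hcone (P : R * R -> Prop) (Y : R -> R -> R -> R) : Prop :=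
  exists z r, P z /\ 0 < r /\ forall a b d, Y a b d = r * hyp a b d z.

Lemma hcone_add P Y1 Y2 : g_convex P -> (forall p, P p -> half_plane p) ->
  hcone P Y1 -> hcone P Y2 -> hcone P (fun a b d => Y1 a b d + Y2 a b d).
Proof.
intros Hc Hh [p [l [Hp [Hl E1]]]] [q [m [Hq [Hm E2]]]].
destruct (segment_combination p q l m (Hh p Hp) (Hh q Hq) Hl Hm)
  as [<- | [z [r [Hz [Hr E]]]]].
- exists p, (l + m); split; [exact Hp|]; split; [lra|].
  intros; rewrite E1, E2; ring.
- exists z, r; split; [now apply (Hc p q)|]; split; [exact Hr|].
  intros; rewrite E1, E2; apply E.
Qed.

Lemma hcone_sum P (lam : nat -> R) (v : nat -> R * R) (n : nat) :
  g_convex P -> (forall p, P p -> half_plane p) ->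
  (forall k, 0 < lam k) -> (forall k, P (v k)) ->
  hcone P (fun a b d => sum_f_R0 (fun k => lam k * hyp a b d (v k)) n).
Proof.
intros Hc Hh Hl Hv; induction n as [|n IH]; simpl.
- exists (v 0%nat), (lam 0%nat); auto.
- apply (hcone_add P _ (fun a b d => lam (S n) * hyp a b d (v (S n)))); auto.
  exists (v (S n)), (lam (S n)); auto.
Qed.

(** A ray from the origin meets the hyperboloid sheet only once. The forms [1 / y] and [x / y] give
    [y' = r y] and [x' = x], and the third form then forces [r ^ 2 = 1]. *)
Lemma hyp_scale_inj z z' r : half_plane z -> half_plane z' -> 0 < r ->
  (forall a b d, hyp a b d z = r * hyp a b d z') -> z = z'.
Proof.
unfold half_plane; destruct z as [x y], z' as [x' y']; simpl; intros H H' Hr E.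
assert (E1 := E 1 0 0); assert (E2 := E 0 1 0); assert (E3 := E 0 0 1).
unfold hyp in *; simpl in *.
assert (Ey : y' = r * y).
{ apply (Rmult_eq_reg_l (/ y * / y')).
  2: assert (0 < / y * / y') by (apply Rmult_lt_0_compat; now apply Rinv_0_lt_compat); lra.
  replace (/ y * / y' * y') with ((1 + 0 * x + 0 * (x * (x * 1) + y * (y * 1))) / y) by (field; lra).
  rewrite E1; field; lra. }
subst y'.
assert (x = x').
{ replace x with ((0 + 1 * x + 0 * (x * (x * 1) + y * (y * 1))) / y * y) by (field; lra).
  rewrite E2; field; lra. }
subst x'.
assert (Q : x * x + y * y = x * x + r * y * (r * y)).
{ replace (x * x + y * y) with ((0 + 0 * x + 1 * (x * (x * 1) + y * (y * 1))) / y * y) by (field; lra).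
  rewrite E3; field; lra. }
f_equal; assert (y ^ 2 * (r - 1) * (r + 1) = 0) by nra.
assert (r = 1); [|subst; ring].
assert (0 < y ^ 2) by nra.
apply Rmult_integral in H0; destruct H0 as [H0|]; [|lra].
apply Rmult_integral in H0; destruct H0; lra.
Qed.

Lemma hcone_mem P z : (forall p, P p -> half_plane p) -> half_plane z ->
  hcone P (fun a b d => hyp a b d z) -> P z.
Proof.
intros Hh Hz [z' [r [Hz' [Hr E]]]].
now rewrite (hyp_scale_inj z z' r Hz (Hh z' Hz') Hr E).
Qed.

Lemma hcone_ext P Y Y' : (forall a b d, Y a b d = Y' a b d) ->
  hcone P Y -> hcone P Y'.
Proof.
intros H [z [r [Hz [Hr E]]]]; exists z, r; split; [exact Hz|]; split; [exact Hr|].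
intros; rewrite <- H; apply E.
Qed.

(** * Trigonometric sums *)

Lemma sum_cos_arith x y N :
  2 * sin (x / 2) * sum_f_R0 (fun k => cos (INR k * x + y)) N =
  sin (INR (S N) * x - x / 2 + y) - sin (y - x / 2).
Proof.
assert (T : forall a b, 2 * sin b * cos a = sin (a + b) - sin (a - b)).
{ intros; rewrite sin_plus, sin_minus; ring. }
induction N as [|N IH].
- simpl sum_f_R0; rewrite T; simpl INR; f_equal; [|f_equal]; f_equal; field.
- rewrite tech5, Rmult_plus_distr_l, IH, T.
  rewrite (S_INR (S N)).
  replace (INR (S N) * x - x / 2 + y) with (INR (S N) * x + y - x / 2) by ring.
  replace ((INR (S N) + 1) * x - x / 2 + y) with (INR (S N) * x + y + x / 2) by field.
  ring.
Qed.

Lemma sum_cos_period (n j : nat) x y : (0 < n)%nat -> sin (x / 2) <> 0 ->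
  INR n * x = 2 * INR j * PI ->
  sum_f_R0 (fun k => cos (INR k * x + y)) (pred n) = 0.
Proof.
intros Hn Hs E; assert (K := sum_cos_arith x y (pred n)).
replace (S (pred n)) with n in K by lia; rewrite E in K.
replace (2 * INR j * PI - x / 2 + y) with ((y - x / 2) + 2 * INR j * PI) in K by ring.
rewrite sin_period, Rminus_diag in K; nra.
Qed.

Definition step (n : nat) : R := 2 * PI / INR n.

Lemma sum_linear (f g h : nat -> R) a b N :
  (forall k, h k = a * f k + b * g k) ->
  sum_f_R0 h N = a * sum_f_R0 f N + b * sum_f_R0 g N.
Proof.
intros H; induction N as [|N IH]; simpl; rewrite H; [ring|].
rewrite IH; ring.
Qed.

Section Sums.
Variable n : nat.
Hypothesis hn : (3 <= n)%nat.

Lemma INR_n_ge3 : 3 <= INR n.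
Proof. apply (le_INR 3) in hn; simpl in hn; lra. Qed.

Lemma angle_bound : 0 < PI / INR n <= PI / 3.
Proof.
assert (H := INR_n_ge3); assert (P := PI_RGT_0); split.
- apply Rdiv_lt_0_compat; lra.
- apply Rmult_le_compat_l; [lra|]; apply Rinv_le_contravar; lra.
Qed.

Lemma sum_cos_step y :
  sum_f_R0 (fun k => cos (INR k * step n + y)) (pred n) = 0.
Proof.
assert (H := INR_n_ge3); assert (A := angle_bound); assert (P := PI_RGT_0).
apply sum_cos_period with 1%nat; [lia | |].
- apply Rgt_not_eq; unfold step.
  replace (2 * PI / INR n / 2) with (PI / INR n) by (field; lra).
  apply sin_gt_0; lra.
- unfold step; simpl INR; field; lra.
Qed.

Lemma sum_cos_double_step y :
  sum_f_R0 (fun k => cos (INR k * (2 * step n) + y)) (pred n) = 0.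
Proof.
assert (H := INR_n_ge3); assert (A := angle_bound); assert (P := PI_RGT_0).
apply sum_cos_period with 2%nat; [lia | |].
- apply Rgt_not_eq; unfold step.
  replace (2 * (2 * PI / INR n) / 2) with (2 * (PI / INR n)) by (field; lra).
  apply sin_gt_0; lra.
- unfold step; simpl INR; field; lra.
Qed.

Lemma sum_const_n a : sum_f_R0 (fun _ => a) (pred n) = INR n * a.
Proof. rewrite sum_cte; replace (S (pred n)) with n by lia; ring. Qed.

(** The harmonics of order 1 and 2 cancel over the [n] directions, the second one because [n >= 3].
    Only the mean remains, in which each square contributes one half. *)
Lemma sum_quadratic_trig A B D E F G (f : nat -> R) :
  (forall k, let c := cos (INR k * step n) in let s := sin (INR k * step n) in
    f k = A + B * c + D * s + E * c ^ 2 + F * s ^ 2 + G * (c * s)) ->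
  sum_f_R0 f (pred n) = INR n * (A + E / 2 + F / 2).
Proof.
intros H.
assert (Hsin : forall x, sin x = cos (x + - (PI / 2))).
{ intros x; rewrite cos_plus, cos_neg, sin_neg, cos_PI2, sin_PI2; ring. }
rewrite (sum_linear (fun k => A + E / 2 + F / 2)
  (fun k => B * cos (INR k * step n) + D * sin (INR k * step n) +
     ((E - F) / 2 * cos (INR k * (2 * step n)) + G / 2 * sin (INR k * (2 * step n))))
  f 1 1 (pred n)).
- rewrite sum_const_n.
  rewrite (sum_linear
    (fun k => B * cos (INR k * step n) + D * sin (INR k * step n))
    (fun k => (E - F) / 2 * cos (INR k * (2 * step n)) + G / 2 * sin (INR k * (2 * step n)))
    _ 1 1) by (intros; cbv beta; ring).
  rewrite (sum_linear (fun k => cos (INR k * step n + 0))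
    (fun k => cos (INR k * step n + - (PI / 2)))
    (fun k => B * cos (INR k * step n) + D * sin (INR k * step n)) B D)
    by (intros; cbv beta; rewrite <- !Hsin, Rplus_0_r; ring).
  rewrite (sum_linear (fun k => cos (INR k * (2 * step n) + 0))
    (fun k => cos (INR k * (2 * step n) + - (PI / 2)))
    (fun k => (E - F) / 2 * cos (INR k * (2 * step n)) + G / 2 * sin (INR k * (2 * step n)))
    ((E - F) / 2) (G / 2))
    by (intros; cbv beta; rewrite <- !Hsin, Rplus_0_r; ring).
  rewrite !sum_cos_step, !sum_cos_double_step; ring.
- intros k; rewrite H; simpl.
  replace (INR k * (2 * step n)) with (2 * (INR k * step n)) by ring.
  rewrite cos_2a, sin_2a.
  assert (Q := sin2_cos2 (INR k * step n)); unfold Rsqr in Q.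
  set (c := cos _) in *; set (s := sin _) in *.
  replace (A + E / 2 + F / 2) with (A + (E / 2 + F / 2) * (s * s + c * c))
    by (rewrite Q; field).
  field.
Qed.

(** Consecutive multiples of [PI / n] lie in a common closed half-period of the sine, since its
    zeros are themselves such multiples. Shifting the index by [n] changes both signs. *)
Lemma sin_consecutive k :
  0 <= sin (INR k * (PI / INR n)) * sin (INR (S k) * (PI / INR n)).
Proof.
assert (H := INR_n_ge3); assert (A := angle_bound); assert (P := PI_RGT_0).
assert (En : INR n * (PI / INR n) = PI) by (field; lra).
induction k as [k IH] using lt_wf_ind.
destruct (Nat.lt_ge_cases k n) as [Hk | Hk].
- apply le_INR in Hk; assert (0 <= INR k) by apply pos_INR.
  rewrite S_INR in *.
  apply Rmult_le_pos; apply sin_ge_0; nra.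
- replace k with ((k - n) + n)%nat by lia.
  replace (S (k - n + n)) with (S (k - n) + n)%nat by lia.
  rewrite !plus_INR, !Rmult_plus_distr_r, En, !neg_sin.
  assert (K := IH (k - n)%nat ltac:(lia)); lra.
Qed.

(** An odd multiple of [PI / n] is never closer than [PI / n] to a multiple of [2 PI]. These are the
    angles between a bisector and the vertex directions, so this provides the hypothesis of
    [ray_exit]. *)
Lemma cos_odd_multiple k :
  cos ((2 * INR k - 1) * (PI / INR n)) <= cos (PI / INR n).
Proof.
set (x := PI / INR n).
assert (E : cos x - cos ((2 * INR k - 1) * x) =
  2 * (sin (INR k * x) * sin ((INR k - 1) * x))).
{ replace (cos x) with (cos (INR k * x - (INR k - 1) * x)) by (f_equal; ring).
  replace ((2 * INR k - 1) * x) with (INR k * x + (INR k - 1) * x) by ring.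
  rewrite cos_plus, cos_minus; ring. }
assert (0 <= sin (INR k * x) * sin ((INR k - 1) * x)); [|lra].
destruct k as [|k].
- simpl INR; rewrite Rmult_0_l, sin_0; lra.
- replace (INR (S k) - 1) with (INR k) by (rewrite S_INR; ring).
  rewrite Rmult_comm; apply sin_consecutive.
Qed.

End Sums.

(** * Polar coordinates about the centre of the polygon *)

(** Hyperboloid coordinates centred at [o]: [xi0 ^ 2 - xi1 ^ 2 - xi2 ^ 2 = 1],
    with [o] at [(1, 0, 0)] and a point at distance [t] from [o] in the unit
    direction [m] at [(cosh t, sinh t * m1, sinh t * m2)]. *)
Definition xi0 (o z : R * R) : R :=
  ((fst z - fst o) ^ 2 + snd z ^ 2 + snd o ^ 2) / (2 * snd o * snd z).
Definition xi1 (o z : R * R) : R := (fst z - fst o) / snd z.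
Definition xi2 (o z : R * R) : R :=
  ((fst z - fst o) ^ 2 + snd z ^ 2 - snd o ^ 2) / (2 * snd o * snd z).

Lemma xi_hyp (o z : R * R) p0 p1 p2 : half_plane o -> half_plane z ->
  p0 * xi0 o z + p1 * xi1 o z + p2 * xi2 o z =
  hyp ((p0 + p2) * fst o ^ 2 / (2 * snd o) + (p0 - p2) * snd o / 2 - p1 * fst o)
      (p1 - (p0 + p2) * fst o / snd o) ((p0 + p2) / (2 * snd o)) z.
Proof.
unfold half_plane, xi0, xi1, xi2, hyp; intros Ho Hz; field; lra.
Qed.

Lemma hyp_xi (o z : R * R) a b d : half_plane o -> half_plane z ->
  let A := (a + b * fst o + d * fst o ^ 2) / snd o in
  hyp a b d z = (A + d * snd o) * xi0 o z + (b + 2 * d * fst o) * xi1 o z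
    + (d * snd o - A) * xi2 o z.
Proof.
intros Ho Hz A; unfold half_plane in *; unfold A, xi0, xi1, xi2, hyp; field; lra.
Qed.

Lemma xi_geodesic c p0 p1 p2 t : geodesic c ->
  let o := c 0 in let w := velocity c 0 in let k := sqrt (speed2 c 0) in
  p0 * xi0 o (c t) + p1 * xi1 o (c t) + p2 * xi2 o (c t) =
  p0 * cosh (k * t)
    + (p1 * fst w + p2 * snd w) / snd o * t * sinhc (k * t).
Proof.
intros H o w k.
assert (Ho : half_plane o) by apply H; assert (Hz : half_plane (c t)) by apply H.
rewrite xi_hyp by auto.
rewrite (geodesic_hyp c _ _ _ H t); fold o w k.
unfold half_plane in Ho.
unfold dhyp, hyp; field; lra.
Qed.

Lemma is_exp_xi o w q : is_exp o w q ->
  let k := sqrt ((fst w ^ 2 + snd w ^ 2) / snd o ^ 2) in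
  half_plane q /\ xi0 o q = cosh k /\
  xi1 o q = fst w / snd o * sinhc k /\ xi2 o q = snd w / snd o * sinhc k.
Proof.
intros [c [H [Ho [Hw <-]]]] k.
assert (Hk : sqrt (speed2 c 0) = k).
{ unfold k; rewrite speed2E, Ho, Hw by apply H; reflexivity. }
assert (E := fun p0 p1 p2 => xi_geodesic c p0 p1 p2 1 H); cbv beta zeta in E.
rewrite Ho, Hw, Hk, !Rmult_1_r in E.
split; [apply H|].
assert (E0 := E 1 0 0); assert (E1 := E 0 1 0); assert (E2 := E 0 0 1).
unfold Rdiv in *; lra.
Qed.

(** The coefficients come from the values and first derivatives of [1 / y] and [x / y] at time 0,
    for the start [o] and the velocity [snd o] times [m], which has Riemannian norm 1 when [m] is a
    Euclidean unit vector. *)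
Definition ray (o m : R * R) : R -> R * R :=
  exp_curve 1 ((1 - snd m) / (2 * snd o)) ((1 + snd m) / (2 * snd o))
   (fst m / 2 + fst o * ((1 - snd m) / (2 * snd o)))
   (- fst m / 2 + fst o * ((1 + snd m) / (2 * snd o))).

Section Ray.
Variables o m : R * R.
Hypotheses (Ho : half_plane o) (Hm : fst m ^ 2 + snd m ^ 2 = 1).

Lemma ray_spec : geodesic (ray o m) /\ speed2 (ray o m) 0 = 1 /\ ray o m 0 = o /\
  velocity (ray o m) 0 = (snd o * fst m, snd o * snd m).
Proof.
unfold half_plane in Ho.
assert (0 <= (1 - snd m) / (2 * snd o)).
{ apply Rdiv_le_0_compat; nra. }
assert (0 <= (1 + snd m) / (2 * snd o)).
{ apply Rdiv_le_0_compat; nra. }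
assert (S : (1 - snd m) / (2 * snd o) + (1 + snd m) / (2 * snd o) = / snd o)
  by (field; lra).
assert (0 < (1 - snd m) / (2 * snd o) + (1 + snd m) / (2 * snd o)).
{ rewrite S; now apply Rinv_0_lt_compat. }
assert (E : ((fst m / 2 + fst o * ((1 - snd m) / (2 * snd o))) * ((1 + snd m) / (2 * snd o)) -
   (- fst m / 2 + fst o * ((1 + snd m) / (2 * snd o))) * ((1 - snd m) / (2 * snd o))) ^ 2 =
  (1 - snd m) / (2 * snd o) * ((1 + snd m) / (2 * snd o))).
{ transitivity (fst m ^ 2 / (2 * snd o) ^ 2); [field; lra|].
  replace (fst m ^ 2) with (1 - snd m ^ 2) by lra; field; lra. }
split; [now apply exp_curve_geodesic|].
split; [unfold ray; rewrite exp_curve_speed by assumption; ring|].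
split.
- unfold ray, exp_curve; rewrite Rmult_0_r, Ropp_0, exp_0, !Rmult_1_r, S.
  transitivity (fst o, snd o); [f_equal; field; lra | now destruct o].
- unfold ray; rewrite exp_curve_velocity by assumption.
  rewrite Rmult_0_r, Ropp_0, exp_0, !Rmult_1_r, S; f_equal; field; lra.
Qed.

Lemma ray_geodesic : geodesic (ray o m).
Proof. apply ray_spec. Qed.

Lemma ray_half_plane t : half_plane (ray o m t).
Proof. apply ray_geodesic. Qed.

Lemma xi_ray t : xi0 o (ray o m t) = cosh t /\
  xi1 o (ray o m t) = sinh t * fst m /\ xi2 o (ray o m t) = sinh t * snd m.
Proof.
destruct ray_spec as [H [Hs [H0 Hv]]]; unfold half_plane in Ho.
assert (E := fun p0 p1 p2 => xi_geodesic _ p0 p1 p2 t H); cbv beta zeta in E.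
rewrite Hs, H0, Hv, sqrt_1, !Rmult_1_l in E; simpl in E.
assert (T := sinhcE t).
assert (E' : forall p0 p1 p2, p0 * xi0 o (ray o m t) + p1 * xi1 o (ray o m t)
   + p2 * xi2 o (ray o m t) = p0 * cosh t + (p1 * fst m + p2 * snd m) * sinh t).
{ intros; rewrite E, <- T; field; lra. }
assert (E0 := E' 1 0 0); assert (E1 := E' 0 1 0); assert (E2 := E' 0 0 1); lra.
Qed.

End Ray.

Definition unit_vertex (n : nat) (e : R * R) (k : nat) : R * R :=
  rotate (INR k * step n) e.

Definition polygon_frame (n : nat) (o e : R * R) (r : R) (v : nat -> R * R) : Prop :=
  half_plane o /\ 0 < r /\ fst e ^ 2 + snd e ^ 2 = 1 /\
  forall k, half_plane (v k) /\ xi0 o (v k) = cosh r /\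
    xi1 o (v k) = sinh r * fst (unit_vertex n e k) /\
    xi2 o (v k) = sinh r * snd (unit_vertex n e k).

Lemma cosh2_xi o p q : half_plane o -> half_plane p -> half_plane q ->
  cosh2 p q = 2 * (xi0 o p * xi0 o q - xi1 o p * xi1 o q - xi2 o p * xi2 o q).
Proof.
unfold half_plane, cosh2, xi0, xi1, xi2; intros; field; lra.
Qed.

Lemma cosh_double x : cosh (2 * x) = cosh x ^ 2 + sinh x ^ 2.
Proof.
unfold cosh, sinh; replace (2 * x) with (x + x) by ring.
rewrite Ropp_plus_distr, !exp_plus; field.
Qed.

Lemma regular_polygon_frame n L P : (3 <= n)%nat -> 0 < L ->
  regular_polygon n L P ->
  exists o e r v, polygon_frame n o e r v /\ L <= 2 * r /\
    (forall z, P z <-> g_hull (fun w => exists k, w = v k) z).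
Proof.
intros hn HL [o [v [Ho [Hrot [HLk HP]]]]].
unfold half_plane in Ho.
assert (Hn := INR_n_ge3 n hn).
assert (Hv : forall k, half_plane (v k) /\ xi0 o (v k) = xi0 o (v 0%nat) /\
  (xi1 o (v k), xi2 o (v k)) =
  rotate (INR k * step n) (xi1 o (v 0%nat), xi2 o (v 0%nat))).
{ intros k; destruct (Hrot k) as [w [H1 H2]].
  replace (2 * PI * INR k / INR n) with (INR k * step n) in H2
    by (unfold step; field; lra).
  apply is_exp_xi in H1, H2; destruct H1 as [_ [A0 [A1 A2]]].
  replace (fst (rotate (INR k * step n) w) ^ 2 + snd (rotate (INR k * step n) w) ^ 2)
    with (fst w ^ 2 + snd w ^ 2) in H2.
  2:{ assert (Q := sin2_cos2 (INR k * step n)); unfold Rsqr in Q.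
      unfold rotate; simpl; set (cc := cos _) in *; set (ss := sin _) in *.
      transitivity ((fst w ^ 2 + snd w ^ 2) * (ss * ss + cc * cc)); [|ring].
      rewrite Q; ring. }
  destruct H2 as [Hh [B0 [B1 B2]]].
  split; [exact Hh|]; split; [now rewrite B0, A0|].
  rewrite B1, B2, A1, A2; unfold rotate; simpl; f_equal; field; lra. }
destruct (Hrot 0%nat) as [w [H1 _]]; apply is_exp_xi in H1.
destruct H1 as [_ [A0 [A1 A2]]].
set (r := sqrt _) in *.
assert (Hr0 : 0 <= r) by apply sqrt_pos.
assert (exists e, fst e ^ 2 + snd e ^ 2 = 1 /\
  xi1 o (v 0%nat) = sinh r * fst e /\ xi2 o (v 0%nat) = sinh r * snd e)
  as [e [He [C1 C2]]].
{ destruct (Req_dec r 0) as [E | E].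
  (* With radius 0 every unit vector serves as [e]; this case is excluded only at the end, by
     [0 < L <= 2 * r]. *)
  - exists (1, 0); simpl.
    assert (Z : fst w ^ 2 + snd w ^ 2 = 0).
    { replace (fst w ^ 2 + snd w ^ 2) with
        ((fst w ^ 2 + snd w ^ 2) / snd o ^ 2 * snd o ^ 2) by (field; lra).
      rewrite (sqrt_eq_0 _) with (2 := E); [ring|].
      apply Rdiv_le_0_compat; nra. }
    assert (fst w = 0) by nra; assert (snd w = 0) by nra.
    rewrite A1, A2, E, sinh_0, H, H0; split; [ring|]; split; unfold Rdiv; ring.
  - exists (fst w / (snd o * r), snd w / (snd o * r)); simpl fst; simpl snd.
    rewrite A1, A2, <- sinhcE; split; [|split; field; lra].
    assert (E2 : r * r = (fst w ^ 2 + snd w ^ 2) / snd o ^ 2).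
    { apply sqrt_sqrt, Rdiv_le_0_compat; nra. }
    transitivity ((fst w ^ 2 + snd w ^ 2) / snd o ^ 2 / (r * r)); [field; lra|].
    rewrite <- E2; field; auto. }
assert (HV : forall k, half_plane (v k) /\ xi0 o (v k) = cosh r /\
    xi1 o (v k) = sinh r * fst (unit_vertex n e k) /\
    xi2 o (v k) = sinh r * snd (unit_vertex n e k)).
{ intros k; destruct (Hv k) as [Hh [E0 E]].
  split; [exact Hh|]; split; [now rewrite E0|].
  rewrite C1, C2 in E; unfold unit_vertex, rotate in *; simpl in *.
  injection E as -> ->; split; ring. }
assert (HLr : L <= 2 * r).
{ rewrite <- (HLk 0%nat).
  destruct (HV 0%nat) as [Hh [E0 [E1 E2]]]; destruct (HV 1%nat) as [Hh' [E0' [E1' E2']]].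
  apply hdist_le; auto; [lra|].
  (* Instead of a triangle inequality through [o]: the hyperbolic law of cosines gives
     [cosh r ^ 2 - sinh r ^ 2 * cos (step n)], and [cos >= -1] bounds it by [cosh (2 * r)]. *)
  rewrite (cosh2_xi o), cosh_double, E0, E1, E2, E0', E1', E2' by auto.
  assert (Hc := COS_bound (step n)).
  assert (Hs : 0 <= sinh r ^ 2) by apply pow2_ge_0.
  apply Rle_trans with (2 * (cosh r ^ 2 - sinh r ^ 2 *
    (cos (step n) * (fst e ^ 2 + snd e ^ 2)))); [|rewrite He; nra].
  right; unfold unit_vertex, rotate; simpl.
  rewrite !Rmult_0_l, cos_0, sin_0, !Rmult_1_l; ring. }
exists o, e, r, v; split; [|split; auto].
split; [exact Ho|]; split; [lra|]; split; assumption.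
Qed.

(** * The polygon *)

Lemma continuous_hyp a b d z : half_plane z -> continuous (hyp a b d) z.
Proof.
unfold half_plane; intros Hz; unfold hyp, Rdiv.
assert (Hf : continuous (fun z : R * R => fst z) z) by apply continuous_fst.
assert (Hs : continuous (fun z : R * R => snd z) z) by apply continuous_snd.
assert (Hpow : forall f : R * R -> R, continuous f z -> continuous (fun z => f z ^ 2) z).
{ intros f H; simpl; apply (continuous_mult (K := R_AbsRing) f); [exact H|].
  apply (continuous_mult (K := R_AbsRing) f (fun _ => 1)); [exact H|].
  apply continuous_const. }
apply (continuous_mult (K := R_AbsRing)
  (fun z => a + b * fst z + d * (fst z ^ 2 + snd z ^ 2)) (fun z => / snd z)).
- apply (continuous_plus (K := R_AbsRing) (V := R_NormedModule)
    (fun z : R * R => a + b * fst z) (fun z => d * (fst z ^ 2 + snd z ^ 2))).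
  + apply (continuous_plus (K := R_AbsRing) (V := R_NormedModule)
      (fun z : R * R => a) (fun z => b * fst z)); [apply continuous_const|].
    apply (continuous_mult (K := R_AbsRing) (fun _ => b)); [apply continuous_const | exact Hf].
  + apply (continuous_mult (K := R_AbsRing) (fun _ => d)
      (fun z : R * R => fst z ^ 2 + snd z ^ 2)); [apply continuous_const|].
    apply (continuous_plus (K := R_AbsRing) (V := R_NormedModule)
      (fun z : R * R => fst z ^ 2) (fun z => snd z ^ 2)); auto.
- apply (continuous_comp (fun z : R * R => snd z) Rinv); [exact Hs|].
  apply continuous_Rinv; lra.
Qed.

Lemma continuous_xi o z p0 p1 p2 : half_plane o -> half_plane z ->
  continuous (fun z => p0 * xi0 o z + p1 * xi1 o z + p2 * xi2 o z) z.
Proof.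
intros Ho Hz; eapply continuous_ext_loc; [|apply continuous_hyp, Hz].
eapply filter_imp.
- intros y Hy; symmetry; apply (xi_hyp o y p0 p1 p2 Ho Hy).
- apply (open_comp snd (fun y => 0 < y)); [|apply open_gt | exact Hz].
  intros x _; apply continuous_snd.
Qed.

Lemma locally_pos (f : R * R -> R) z : continuous f z -> 0 < f z ->
  locally z (fun y => 0 < f y).
Proof.
intros Hf Hz; apply (Hf (fun y => 0 < y)).
now apply (open_gt 0).
Qed.

Lemma half_plane_open z : half_plane z -> locally z half_plane.
Proof. intros H; apply (locally_pos snd); [apply continuous_snd | exact H]. Qed.

Section Hull.
Variables (V : R * R -> Prop).
Hypothesis HV : forall w, V w -> half_plane w.

Lemma g_convex_half_plane : g_convex half_plane.
Proof. intros p q z _ _ [c [H [_ [_ [t [_ ->]]]]]]; apply H. Qed.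

Lemma g_hull_half_plane z : g_hull V z -> half_plane z.
Proof. intros H; apply H; auto using g_convex_half_plane. Qed.

Lemma g_hull_mem z : V z -> g_hull V z.
Proof. intros H C _ _ HC; auto. Qed.

Lemma g_hull_convex : g_convex (g_hull V).
Proof.
intros p q z Hp Hq Hz C Hh Hc HC.
apply (Hc p q z); [apply Hp | apply Hq |]; auto.
Qed.

End Hull.

Lemma g_convex_hyp_ge0 a b d : g_convex (fun z => half_plane z /\ 0 <= hyp a b d z).
Proof.
intros p q z [Hp Hp'] [Hq Hq'] Hz; split.
- now apply (g_convex_half_plane p q).
- now apply (hyp_segment_ge0 p q).
Qed.

Section Polygon.
Variables (n : nat) (o e : R * R) (r : R) (v : nat -> R * R).
Hypothesis hn : (3 <= n)%nat.
Hypothesis frame : polygon_frame n o e r v.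
Let P := g_hull (fun w => exists k, w = v k).

Lemma vertices_half_plane w : (exists k, w = v k) -> half_plane w.
Proof. intros [k ->]; apply frame. Qed.

Lemma frame_center : half_plane o.
Proof. apply frame. Qed.

(** A Parseval identity: the directions of the vertices form a tight frame. *)
Lemma vertex_decomposition p0 p1 p2 d0 d1 d2 :
  sum_f_R0 (fun k =>
    (d0 / (INR n * cosh r) + 2 / (INR n * sinh r) *
      (d1 * fst (unit_vertex n e k) + d2 * snd (unit_vertex n e k))) *
    (p0 * xi0 o (v k) + p1 * xi1 o (v k) + p2 * xi2 o (v k))) (pred n) =
  p0 * d0 + p1 * d1 + p2 * d2.
Proof.
destruct frame as [Ho [Hr [He Hv]]].
assert (Hn := INR_n_ge3 n hn).
assert (HC := cosh_gt0 r); assert (HS := sinh_gt0 r Hr).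
set (m0 := d0 / (INR n * cosh r)); set (q := 2 / (INR n * sinh r)).
set (a := d1 * fst e + d2 * snd e); set (b := d2 * fst e - d1 * snd e).
set (al := p1 * fst e + p2 * snd e); set (be := p2 * fst e - p1 * snd e).
rewrite (sum_quadratic_trig n hn (m0 * p0 * cosh r)
  (m0 * sinh r * al + q * a * p0 * cosh r)
  (m0 * sinh r * be + q * b * p0 * cosh r)
  (q * sinh r * a * al) (q * sinh r * b * be)
  (q * sinh r * (a * be + b * al))).
- transitivity (p0 * d0 + (p1 * d1 + p2 * d2) * (fst e ^ 2 + snd e ^ 2)).
  + unfold m0, q, a, b, al, be; field; lra.
  + rewrite He; ring.
- intros k c s; destruct (Hv k) as [_ [-> [-> ->]]].
  unfold unit_vertex, rotate; simpl fst; simpl snd; fold c s.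
  unfold a, b, al, be; ring.
Qed.

Lemma unit_vertex_norm k :
  fst (unit_vertex n e k) ^ 2 + snd (unit_vertex n e k) ^ 2 = 1.
Proof.
destruct frame as [_ [_ [He _]]].
assert (Q := sin2_cos2 (INR k * step n)); unfold Rsqr in Q.
unfold unit_vertex, rotate; simpl fst; simpl snd.
set (c := cos _) in *; set (s := sin _) in *.
transitivity ((fst e ^ 2 + snd e ^ 2) * (s * s + c * c)); [ring|].
rewrite Q, He; ring.
Qed.

(** The vector of [z] minus [b] times that of [v j] is expanded in the tight frame, and the
    inequality makes all coefficients [mu k] positive: its central component outweighs the others.
    Removing a multiple of [v j] beforehand lets the criterion reach points near that vertex;
    [b = 0] would only give a neighbourhood of the centre. *)
Lemma in_polygon z b j : half_plane z -> 0 <= b ->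
  0 < sinh r * (xi0 o z - b * cosh r) - 2 * cosh r *
    (Rabs (xi1 o z - b * xi1 o (v j)) + Rabs (xi2 o z - b * xi2 o (v j))) ->
  P z.
Proof.
intros Hz Hb Hpos.
assert (Hn := INR_n_ge3 n hn); assert (Ho := frame_center).
assert (Hr : 0 < r) by apply frame.
assert (HC := cosh_gt0 r); assert (HS := sinh_gt0 r Hr).
set (d0 := xi0 o z - b * cosh r) in *.
set (d1 := xi1 o z - b * xi1 o (v j)) in *.
set (d2 := xi2 o z - b * xi2 o (v j)) in *.
assert (HP : forall p, P p -> half_plane p).
{ apply g_hull_half_plane, vertices_half_plane. }
assert (Hc : g_convex P) by apply g_hull_convex.
assert (HPv : forall k, P (v k)) by (intros k; apply g_hull_mem; eauto).
apply hcone_mem; auto.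
set (mu := fun k => d0 / (INR n * cosh r) + 2 / (INR n * sinh r) *
      (d1 * fst (unit_vertex n e k) + d2 * snd (unit_vertex n e k))).
assert (Hmu : forall k, 0 < mu k).
{ intros k; unfold mu.
  replace (d0 / (INR n * cosh r) + 2 / (INR n * sinh r) *
      (d1 * fst (unit_vertex n e k) + d2 * snd (unit_vertex n e k))) with
   ((sinh r * d0 + 2 * cosh r * (d1 * fst (unit_vertex n e k) +
      d2 * snd (unit_vertex n e k))) / (INR n * cosh r * sinh r)) by (field; lra).
  apply Rdiv_lt_0_compat; [|apply Rmult_lt_0_compat; [apply Rmult_lt_0_compat|]; lra].
  assert (N := unit_vertex_norm k).
  assert (B : forall x y, y ^ 2 <= 1 -> - Rabs x <= x * y).
  { intros x y Hy; assert (Hx := Rabs_pos x).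
    assert (-1 <= y <= 1) by (split; nra).
    destruct (Rle_dec 0 x).
    - rewrite Rabs_right in * by lra; nra.
    - rewrite Rabs_left in * by lra; nra. }
  assert (B1 := B d1 (fst (unit_vertex n e k)) ltac:(assert (T := pow2_ge_0 (snd (unit_vertex n e k))); lra)).
  assert (B2 := B d2 (snd (unit_vertex n e k)) ltac:(assert (T := pow2_ge_0 (fst (unit_vertex n e k))); lra)).
  nra. }
assert (E : forall a' b' d',
  sum_f_R0 (fun k => mu k * hyp a' b' d' (v k)) (pred n) + b * hyp a' b' d' (v j)
  = hyp a' b' d' z).
{ intros a' b' d'.
  rewrite (hyp_xi o z), (hyp_xi o (v j)) by (auto; apply frame).
  set (A := (a' + b' * fst o + d' * fst o ^ 2) / snd o).
  rewrite (sum_eq _ (fun k => mu k * ((A + d' * snd o) * xi0 o (v k) +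
     (b' + 2 * d' * fst o) * xi1 o (v k) + (d' * snd o - A) * xi2 o (v k)))).
  - unfold mu; rewrite vertex_decomposition; unfold d0, d1, d2.
    destruct frame as [_ [_ [_ Hv]]]; destruct (Hv j) as [_ [-> _]]; ring.
  - intros k _; now rewrite (hyp_xi o (v k)) by (auto; apply frame). }
apply (hcone_ext _ _ _ E).
assert (K := hcone_sum P mu v (pred n) Hc HP Hmu HPv).
destruct Hb as [Hb | <-].
- apply (hcone_add P _ (fun a b' d => b * hyp a b' d (v j))); auto.
  exists (v j), b; auto.
- eapply hcone_ext; [|exact K]; intros; simpl; ring.
Qed.

Lemma interior_polygon z a b j : half_plane z -> 0 < a -> 0 <= b ->
  xi0 o z = a + b * cosh r -> xi1 o z = b * xi1 o (v j) ->
  xi2 o z = b * xi2 o (v j) -> h_interior P z.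
Proof.
intros Hz Ha Hb E0 E1 E2.
assert (Ho := frame_center).
assert (Hr : 0 < r) by apply frame.
assert (HC := cosh_gt0 r); assert (HS := sinh_gt0 r Hr).
assert (X := fun p0 p1 p2 => continuous_xi o z p0 p1 p2 Ho Hz).
assert (HL : forall p1 p2, locally z (fun y => 0 <
  sinh r * (xi0 o y - b * cosh r) - 2 * cosh r *
  (p1 * (xi1 o y - b * xi1 o (v j)) + p2 * (xi2 o y - b * xi2 o (v j))))).
{ intros p1 p2; apply locally_pos.
  - eapply continuous_ext; [|apply (continuous_plus (K := R_AbsRing)
      (V := R_NormedModule) _ (fun _ => - sinh r * b * cosh r +
        2 * cosh r * b * (p1 * xi1 o (v j) + p2 * xi2 o (v j)))
      z (X (sinh r) (- 2 * cosh r * p1) (- 2 * cosh r * p2)));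
      apply continuous_const].
    intros y; unfold plus; simpl; ring.
  - rewrite E0, E1, E2.
    replace (sinh r * (a + b * cosh r - b * cosh r) - 2 * cosh r *
     (p1 * (b * xi1 o (v j) - b * xi1 o (v j)) + p2 * (b * xi2 o (v j) - b * xi2 o (v j))))
     with (sinh r * a) by ring; nra. }
(* The sum of two absolute values is the maximum over four choices of signs, each giving a
   continuous function with value [sinh r * a] at [z]. *)
assert (H1 := HL 1 1); assert (H2 := HL 1 (-1)).
assert (H3 := HL (-1) 1); assert (H4 := HL (-1) (-1)).
unfold h_interior.
generalize (filter_and _ _ (half_plane_open z Hz)
  (filter_and _ _ (filter_and _ _ H1 H2) (filter_and _ _ H3 H4))).
apply filter_imp; intros y [Hy [[K1 K2] [K3 K4]]].
apply (in_polygon y b j Hy Hb).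
unfold Rabs at 1 2; destruct (Rcase_abs _), (Rcase_abs _); lra.
Qed.

Lemma vertex_ray_interior j t : 0 <= t < r ->
  h_interior P (ray o (unit_vertex n e j) t).
Proof.
intros [Ht Htr].
assert (Ho := frame_center); assert (Hm := unit_vertex_norm j).
assert (HS := sinh_gt0 r ltac:(lra)); assert (Hst := sinh_ge0 t Ht).
destruct (xi_ray o _ Ho Hm t) as [E0 [E1 E2]].
assert (Hv := proj2 (proj2 (proj2 frame)) j).
destruct Hv as [_ [F0 [F1 F2]]].
assert (HD := sinh_gt0 (r - t) ltac:(lra)); rewrite sinh_minus in HD.
(* These are the interpolation weights of [o] and [v j] on the segment between them; the first
   equals [sinh (r - t) / sinh r], positive because [t < r]. *)
apply (interior_polygon _ (cosh t - sinh t / sinh r * cosh r) (sinh t / sinh r) j).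
- apply ray_half_plane; auto.
- replace (cosh t - sinh t / sinh r * cosh r) with
   ((sinh r * cosh t - cosh r * sinh t) / sinh r) by (field; lra).
  apply Rdiv_lt_0_compat; lra.
- apply Rdiv_le_0_compat; lra.
- rewrite E0; ring.
- rewrite E1, F1; field; lra.
- rewrite E2, F2; field; lra.
Qed.

(** The geodesic cutting off the direction [m] is chosen with ideal endpoints at
    angle [PI / n] on each side of [m], so that it does not depend on [r]. *)
Lemma ray_exit m t : fst m ^ 2 + snd m ^ 2 = 1 ->
  (forall k, fst m * fst (unit_vertex n e k) + snd m * snd (unit_vertex n e k)
     <= cos (PI / INR n)) ->
  cosh t * cos (PI / INR n) < sinh t -> ~ h_interior P (ray o m t).
Proof.
intros Hm Hk Ht Hin; apply locally_singleton in Hin.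
assert (Ho := frame_center); assert (Hr : 0 < r) by apply frame.
assert (HC := cosh_gt0 r); assert (HS := sinh_gt0 r Hr).
(* The separating form is [cos (PI / n) * xi0] minus the component of [(xi1, xi2)] along [m]. At a
   vertex it is at least [cos (PI / n) * (cosh r - sinh r) >= 0]; at the point of the ray it is
   [cosh t * cos (PI / n) - sinh t < 0]. *)
assert (E := fun z Hz => xi_hyp o z (cos (PI / INR n)) (- fst m) (- snd m) Ho Hz).
assert (Hcos : 0 <= cos (PI / INR n)).
{ assert (A := angle_bound n hn); assert (Q := PI_RGT_0).
  apply cos_ge_0; lra. }
assert (Hsc : sinh r <= cosh r).
{ unfold cosh, sinh; assert (T := exp_pos (- r)); lra. }
assert (K := Hin _ (fun p (H : half_plane p /\ _) => proj1 H) (g_convex_hyp_ge0 _ _ _)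
  : (forall p, _ -> half_plane p /\ 0 <= hyp
   ((cos (PI / INR n) + - snd m) * fst o ^ 2 / (2 * snd o) + (cos (PI / INR n) - - snd m) * snd o / 2 - - fst m * fst o)
      (- fst m - (cos (PI / INR n) + - snd m) * fst o / snd o) ((cos (PI / INR n) + - snd m) / (2 * snd o)) p) -> _).
destruct K as [Hz K].
- intros w [k ->].
  destruct (proj2 (proj2 (proj2 frame)) k) as [Hv [F0 [F1 F2]]].
  split; [exact Hv|].
  rewrite <- (E _ Hv), F0, F1, F2; assert (T := Hk k); nra.
- rewrite <- (E _ Hz) in K; destruct (xi_ray o m Ho Hm t) as [F0 [F1 F2]].
  rewrite F0, F1, F2 in K.
  assert (sinh t * (fst m ^ 2 + snd m ^ 2) = sinh t) by (rewrite Hm; ring).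
  nra.
Qed.

(** Clearing denominators and using [cos x = 1 - 2 sin (x / 2) ^ 2] with [x = PI / N], the claim is
    [1 < (N ^ 2 + 1) * sin (x / 2) ^ 2]. It follows from [N * sin (x / 2) >= 1]: the cubic Taylor
    bound loses at most a factor 8/9, while [N * (x / 2) = PI / 2 > 3 / 2]. *)
Lemma ln_exit : cosh (ln (INR n)) * cos (PI / INR n) < sinh (ln (INR n)).
Proof.
assert (Hn := INR_n_ge3 n hn); assert (A := angle_bound n hn).
assert (HPI := PI_RGT_0); assert (H4 := PI_4); assert (H3 := PI2_3_2).
set (N := INR n) in *; set (x := PI / N) in *.
assert (Hx : N * x = PI) by (unfold x; field; lra).
unfold cosh, sinh; rewrite exp_Ropp, !exp_ln by lra.
assert (Hc : cos x = 1 - 2 * sin (x / 2) ^ 2).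
{ replace x with (2 * (x / 2)) at 1 by field; rewrite cos_2a_sin; ring. }
assert (Hs : 1 <= N * sin (x / 2)).
{ destruct (pre_sin_bound (x / 2) 0 ltac:(lra) ltac:(lra)) as [S1 _].
  unfold sin_approx, sin_term in S1; simpl in S1.
  assert (x / 2 - (x / 2) ^ 3 / 6 <= sin (x / 2)) by (eapply Rle_trans; [|exact S1]; right; field).
  assert (Hx1 : x <= 4 / 3) by lra.
  assert (x / 2 * (8 / 9) <= sin (x / 2)) by nra.
  nra. }
assert (Hs2 : 1 <= N ^ 2 * sin (x / 2) ^ 2).
{ replace (N ^ 2 * sin (x / 2) ^ 2) with ((N * sin (x / 2)) ^ 2) by ring; nra. }
rewrite Hc.
apply (Rmult_lt_reg_r (2 * N)); [lra|].
replace ((N + / N) / 2 * (1 - 2 * sin (x / 2) ^ 2) * (2 * N)) with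
  (N ^ 2 + 1 - 2 * (N ^ 2 * sin (x / 2) ^ 2) - 2 * sin (x / 2) ^ 2) by (field; lra).
replace ((N - / N) / 2 * (2 * N)) with (N ^ 2 - 1) by (field; lra).
assert (0 < sin (x / 2)); [|nra].
apply sin_gt_0; lra.
Qed.

End Polygon.

(** * Calculus in the chart *)

Definition insert (i : idx) (p : R * R) (x : R) : R * R :=
  match i with i1 => (x, snd p) | i2 => (fst p, x) end.

Lemma locally_insert (Q : R * R -> Prop) i p : locally p Q ->
  locally (coord p i) (fun x => Q (insert i p x)).
Proof.
intros [eps H]; exists eps; intros x Hx; apply H.
destruct i; split; simpl; auto; apply ball_center.
Qed.

Lemma sliceE i f p x : slice i f p x = f (insert i p x).
Proof. now destruct i. Qed.

Lemma pd_ext_loc i f h p : locally p (fun q => f q = h q) -> pd i f p = pd i h p.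
Proof.
intros H; apply Derive_ext_loc.
generalize (locally_insert _ i p H); apply filter_imp; intros x.
now rewrite !sliceE.
Qed.

Lemma ex_pd_ext_loc i f h p : locally p (fun q => f q = h q) ->
  ex_pd i f p -> ex_pd i h p.
Proof.
intros H; apply ex_derive_ext_loc.
generalize (locally_insert _ i p H); apply filter_imp; intros x.
now rewrite !sliceE.
Qed.

Lemma insert_coord i p : insert i p (coord p i) = p.
Proof. now destruct i, p. Qed.

Section Smooth.
Variable D : R * R -> Prop.
Hypothesis Dopen : forall p, D p -> locally p D.

Lemma Ck1_ext f h : (forall p, D p -> f p = h p) -> Ck 1 D f -> Ck 1 D h.
Proof.
intros E [Hc Hd].
assert (EL : forall p, D p -> locally p (fun q => f q = h q)).
{ intros p Hp; generalize (Dopen p Hp); apply filter_imp, E. }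
split.
- intros p Hp; apply (continuous_ext_loc _ f); auto.
- intros i; destruct (Hd i) as [H1 [H2 _]]; split.
  + intros p Hp; apply (ex_pd_ext_loc i f); auto.
  + split; [|exact I]; intros p Hp.
    apply (continuous_ext_loc _ (pd i f)); auto.
    generalize (Dopen p Hp); apply filter_imp; intros q Hq.
    apply pd_ext_loc; auto.
Qed.

Lemma Ck1_opp f : Ck 1 D f -> Ck 1 D (fun p => - f p).
Proof.
intros [Hc Hd]; split.
- intros p Hp; apply (continuous_opp (K := R_AbsRing) (V := R_NormedModule) f); auto.
- intros i; destruct (Hd i) as [H1 [H2 _]].
  assert (H : forall p, D p -> is_derive (slice i (fun p => - f p) p) (coord p i) (- pd i f p)).
  { intros p Hp; apply (is_derive_ext (fun x => - slice i f p x)).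
    - intros x; now rewrite !sliceE.
    - apply (is_derive_opp (K := R_AbsRing) (V := R_NormedModule) (slice i f p)).
      now apply Derive_correct, H1. }
  split; [intros p Hp; eexists; now apply H|]; split; [|exact I].
  intros p Hp; apply (continuous_ext_loc _ (fun q => - pd i f q)).
  + generalize (Dopen p Hp); apply filter_imp; intros q Hq.
    symmetry; apply is_derive_unique, H, Hq.
  + apply (continuous_opp (K := R_AbsRing) (V := R_NormedModule) (pd i f)); auto.
Qed.

Lemma Ck1_plus f h : Ck 1 D f -> Ck 1 D h -> Ck 1 D (fun p => f p + h p).
Proof.
intros [Hc Hd] [Kc Kd]; split.
- intros p Hp; apply (continuous_plus (K := R_AbsRing) (V := R_NormedModule) f h); auto.
- intros i; destruct (Hd i) as [H1 [H2 _]], (Kd i) as [K1 [K2 _]].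
  assert (H : forall p, D p ->
    is_derive (slice i (fun p => f p + h p) p) (coord p i) (pd i f p + pd i h p)).
  { intros p Hp; apply (is_derive_ext (fun x => slice i f p x + slice i h p x)).
    - intros x; now rewrite !sliceE.
    - apply (is_derive_plus (K := R_AbsRing) (V := R_NormedModule) (slice i f p));
      [now apply Derive_correct, H1 | now apply Derive_correct, K1]. }
  split; [intros p Hp; eexists; now apply H|]; split; [|exact I].
  intros p Hp; apply (continuous_ext_loc _ (fun q => pd i f q + pd i h q)).
  + generalize (Dopen p Hp); apply filter_imp; intros q Hq.
    symmetry; apply is_derive_unique, H, Hq.
  + apply (continuous_plus (K := R_AbsRing) (V := R_NormedModule) (pd i f)); auto.
Qed.

Lemma Ck1_mult f h : Ck 1 D f -> Ck 1 D h -> Ck 1 D (fun p => f p * h p).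
Proof.
intros [Hc Hd] [Kc Kd]; split.
- intros p Hp; apply (continuous_mult (K := R_AbsRing) f h); auto.
- intros i; destruct (Hd i) as [H1 [H2 _]], (Kd i) as [K1 [K2 _]].
  assert (H : forall p, D p ->
    is_derive (slice i (fun p => f p * h p) p) (coord p i)
      (pd i f p * h p + f p * pd i h p)).
  { intros p Hp; apply (is_derive_ext (fun x => slice i f p x * slice i h p x)).
    - intros x; now rewrite !sliceE.
    - replace (h p) with (slice i h p (coord p i)) by now rewrite sliceE, insert_coord.
      replace (f p) with (slice i f p (coord p i)) by now rewrite sliceE, insert_coord.
      apply (is_derive_mult (K := R_AbsRing) (slice i f p) (slice i h p));
      [now apply Derive_correct, H1 | now apply Derive_correct, K1 | apply Rmult_comm]. }
  split; [intros p Hp; eexists; now apply H|]; split; [|exact I].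
  intros p Hp; apply (continuous_ext_loc _ (fun q => pd i f q * h q + f q * pd i h q)).
  + generalize (Dopen p Hp); apply filter_imp; intros q Hq.
    symmetry; apply is_derive_unique, H, Hq.
  + apply (continuous_plus (K := R_AbsRing) (V := R_NormedModule)
      (fun q => pd i f q * h q) (fun q => f q * pd i h q)).
    * apply (continuous_mult (K := R_AbsRing) (pd i f) h); auto.
    * apply (continuous_mult (K := R_AbsRing) f (pd i h)); auto.
Qed.

Lemma Ck1_const a : Ck 1 D (fun _ => a).
Proof.
split; [intros; apply continuous_const|].
intros i; split.
- intros p _; apply (ex_derive_ext (fun _ => a)).
  + intros x; now rewrite sliceE.
  + apply ex_derive_const.
- split; [|exact I]; intros p _.
  apply (continuous_ext (fun _ => 0)); [|apply continuous_const].
  intros q; symmetry; destruct i; unfold pd, slice; apply Derive_const.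
Qed.

Hypothesis Dhalf : forall p, D p -> half_plane p.

Lemma Ck1_inv_snd : Ck 1 D (fun p => / snd p).
Proof.
assert (Hc : forall p, D p -> continuous (fun p : R * R => / snd p) p).
{ intros p Hp; apply Dhalf in Hp; unfold half_plane in Hp.
  apply (continuous_comp (fun z : R * R => snd z) Rinv); [apply continuous_snd|].
  apply continuous_Rinv; lra. }
split; [exact Hc|].
intros [|]; split.
- intros p _; apply (ex_derive_ext (fun _ => / snd p));
    [reflexivity | apply ex_derive_const].
- split; [|exact I]; intros p _.
  apply (continuous_ext (fun _ => 0)); [|apply continuous_const].
  intros q; symmetry; exact (Derive_const (/ snd q) (fst q)).
- intros p Hp; apply Dhalf in Hp; unfold half_plane in Hp.
  unfold ex_pd; simpl; auto_derive; lra.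
- split; [|exact I]; intros p Hp.
  apply (continuous_ext_loc _ (fun q => - (/ snd q * / snd q))).
  + generalize (Dopen p Hp); apply filter_imp; intros q Hq.
    apply Dhalf in Hq; unfold half_plane in Hq.
    symmetry; apply is_derive_unique; simpl; auto_derive; [lra | field; lra].
  + apply (continuous_opp (K := R_AbsRing) (V := R_NormedModule)).
    apply (continuous_mult (K := R_AbsRing) (fun q => / snd q) (fun q => / snd q)); auto.
Qed.

Lemma Ck1_christoffel k i j : Ck 1 D (christoffel k i j).
Proof.
apply (Ck1_ext (fun p => match k, i, j with
    | i1, i1, i2 | i1, i2, i1 | i2, i2, i2 => -1
    | i2, i1, i1 => 1
    | _, _, _ => 0
    end * / snd p)).
- intros p Hp; rewrite christoffel_half_plane by now apply Dhalf.
  destruct k, i, j; ring.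
- apply Ck1_mult; [apply Ck1_const | apply Ck1_inv_snd].
Qed.

Lemma Ck_S k f : Ck (S k) D f -> Ck k D f.
Proof.
revert f; induction k as [|k IH]; intros f [Hc Hd]; split; auto.
intros i; destruct (Hd i) as [H1 H2]; split; auto.
Qed.

Lemma Ck_pd k f i : Ck (S k) D f -> Ck k D (pd i f).
Proof. intros [_ H]; apply H. Qed.

Lemma Ck1_hess_coef f i j : Ck 3 D f -> Ck 1 D (hess_coef f i j).
Proof.
intros H; unfold hess_coef, sum2, Rminus.
assert (H1 : forall k, Ck 1 D (pd k f)) by (intros k; now apply Ck_S, Ck_pd).
apply Ck1_plus; [now apply Ck_pd, Ck_pd|].
apply Ck1_opp, Ck1_plus; apply Ck1_mult; auto using Ck1_christoffel.
Qed.

(** [Ck] speaks of partial derivatives only; their continuity gives the total derivative that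
    composition with a curve requires. *)
Lemma chain_rule f (c : R -> R * R) t : Ck 1 D f -> D (c t) ->
  ex_derive (crd c i1) t -> ex_derive (crd c i2) t ->
  is_derive (fun s => f (c s)) t
    (pd i1 f (c t) * fst (velocity c t) + pd i2 f (c t) * snd (velocity c t)).
Proof.
intros [Hc Hd] Hp H1 H2.
destruct (Hd i1) as [D1 [C1 _]], (Hd i2) as [D2 [C2 _]].
apply (is_derive_ext (fun s => f (crd c i1 s, crd c i2 s))).
{ intros s; unfold crd, coord; now rewrite <- surjective_pairing. }
apply is_derive_Reals.
apply (derivable_pt_lim_comp_2d (fun x y => f (x, y)) (crd c i1) (crd c i2)).
2, 3: now apply is_derive_Reals, Derive_correct.
apply filterdiff_differentiable_pt_lim.
assert (Ep : (crd c i1 t, crd c i2 t) = c t).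
{ unfold crd, coord; now rewrite <- surjective_pairing. }
eapply filterdiff_ext_lin.
- apply (is_derive_filterdiff (fun x y => f (x, y)) (crd c i1 t) (crd c i2 t)
    (fun x y => pd i1 f (x, y)) (pd i2 f (c t))).
  + rewrite Ep; generalize (Dopen _ Hp); apply filter_imp; intros [x y] Hq.
    exact (Derive_correct _ _ (D1 _ Hq)).
  + exact (Derive_correct _ _ (D2 _ Hp)).
  + rewrite Ep; apply (continuous_ext (pd i1 f)); [now intros []|auto].
- intros y; rewrite Ep; reflexivity.
Qed.

End Smooth.

(** * Self-concordance along geodesics *)

Definition dir_derive (F : R * R -> R) (p v : R * R) : R :=
  pd i1 F p * fst v + pd i2 F p * snd v.

Lemma inner_grad F p v : half_plane p -> inner p (grad F p) v = dir_derive F p v.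
Proof.
unfold half_plane; intros Hp; unfold inner, grad, dir_derive, sum2, vec, g, g_inv.
simpl; field; lra.
Qed.

Lemma derive_linear_form (a b x y : R -> R) t a' b' x' y' :
  is_derive a t a' -> is_derive b t b' -> is_derive x t x' -> is_derive y t y' ->
  is_derive (fun s => a s * x s + b s * y s) t
    (a' * x t + a t * x' + (b' * y t + b t * y')).
Proof.
intros Ha Hb Hx Hy; auto_derive.
- repeat match goal with |- _ /\ _ => split end; try (eexists; eassumption); exact I.
- apply is_derive_unique in Ha, Hb, Hx, Hy.
  change (fun x => a x) with a; change (fun x => b x) with b.
  change (fun z => x z) with x; change (fun z => y z) with y.
  rewrite Ha, Hb, Hx, Hy; ring.
Qed.

(** The mixed coefficients [b] and [c] stay separate because [hess] sums over ordered pairs of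
    indices. *)
Lemma derive_quadratic_form (a b c d x y : R -> R) t a' b' c' d' x' y' :
  is_derive a t a' -> is_derive b t b' -> is_derive c t c' -> is_derive d t d' ->
  is_derive x t x' -> is_derive y t y' ->
  is_derive (fun s => a s * x s * x s + b s * x s * y s
    + (c s * y s * x s + d s * y s * y s)) t
    (a' * x t * x t + b' * x t * y t + (c' * y t * x t + d' * y t * y t)
     + 2 * a t * x t * x' + (b t + c t) * (x' * y t + x t * y')
     + 2 * d t * y t * y').
Proof.
intros Ha Hb Hc Hd Hx Hy; auto_derive.
- repeat match goal with |- _ /\ _ => split end; try (eexists; eassumption); exact I.
- apply is_derive_unique in Ha, Hb, Hc, Hd, Hx, Hy.
  change (fun x => a x) with a; change (fun x => b x) with b.
  change (fun x => c x) with c; change (fun x => d x) with d.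
  change (fun z => x z) with x; change (fun z => y z) with y.
  rewrite Ha, Hb, Hc, Hd, Hx, Hy; ring.
Qed.

Section Along.
Variables (D : R * R -> Prop) (F : R * R -> R) (c : R -> R * R) (t : R).
Hypothesis Dopen : forall p, D p -> locally p D.
Hypothesis Dhalf : forall p, D p -> half_plane p.
Hypothesis HF : Ck 3 D F.
Hypothesis Hc : geodesic c.
Hypothesis Ht : D (c t).

Lemma chain_along f : Ck 1 D f ->
  is_derive (fun s => f (c s)) t (dir_derive f (c t) (velocity c t)).
Proof.
intros Hf; exact (chain_rule D Dopen f c t Hf Ht
  (proj1 (proj2 (Hc t) i1)) (proj1 (proj2 (Hc t) i2))).
Qed.

Lemma derive_along0 :
  is_derive (fun s => F (c s)) t (dir_derive F (c t) (velocity c t)).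
Proof. exact (chain_along F (Ck_S D 1 F (Ck_S D 2 F HF))). Qed.

(** The second derivatives of the coordinates, replaced through the geodesic equation, are exactly
    the Christoffel terms of [hess]. The same cancellation gives [third] one order higher. *)
Lemma derive_along1 :
  is_derive (fun s => dir_derive F (c s) (velocity c s)) t
    (hess F (c t) (velocity c t) (velocity c t)).
Proof.
assert (Hp := Dhalf _ Ht).
destruct (geodesic_derives c Hc t) as [_ [_ [_ [Hxx Hyy]]]].
assert (A : forall i, is_derive (fun s => pd i F (c s)) t
   (dir_derive (pd i F) (c t) (velocity c t))).
{ intros i; exact (chain_along _ (Ck_S D 1 _ (Ck_pd D 2 F i HF))). }
evar_last.
- exact (derive_linear_form _ _ _ _ _ _ _ _ _ (A i1) (A i2) Hxx Hyy).
- cbv beta; unfold hess, hess_coef, dir_derive, sum2.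
  rewrite !christoffel_half_plane by exact Hp.
  unfold half_plane in Hp.
  destruct (velocity c t) as [v1 v2]; unfold coord.
  simpl; field; lra.
Qed.

Lemma derive_along2 :
  is_derive (fun s => hess F (c s) (velocity c s) (velocity c s)) t
    (third F (c t) (velocity c t) (velocity c t) (velocity c t)).
Proof.
assert (Hp := Dhalf _ Ht).
destruct (geodesic_derives c Hc t) as [_ [_ [_ [Hxx Hyy]]]].
assert (A : forall i j, is_derive (fun s => hess_coef F i j (c s)) t
   (dir_derive (hess_coef F i j) (c t) (velocity c t))).
{ intros i j; exact (chain_along _ (Ck1_hess_coef D Dopen Dhalf F i j HF)). }
evar_last.
- exact (derive_quadratic_form _ _ _ _ _ _ _ _ _ _ _ _ _
    (A i1 i1) (A i1 i2) (A i2 i1) (A i2 i2) Hxx Hyy).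
- cbv beta; unfold third, third_coef, dir_derive, sum2.
  rewrite !christoffel_half_plane by exact Hp.
  unfold half_plane in Hp.
  destruct (velocity c t) as [v1 v2]; unfold coord.
  simpl; field; lra.
Qed.

End Along.

Lemma derive_nonneg_le (f df : R -> R) a b : a <= b ->
  (forall s, a <= s <= b -> is_derive f s (df s) /\ 0 <= df s) -> f a <= f b.
Proof.
intros Hab H.
destruct (MVT_gen f a b df) as [s [Hs E]].
- rewrite Rmin_left, Rmax_right by lra; intros s Hs; apply H; lra.
- rewrite Rmin_left, Rmax_right by lra; intros s Hs.
  apply continuity_pt_filterlim, (ex_derive_continuous f).
  exists (df s); apply H; lra.
- rewrite Rmin_left, Rmax_right in Hs by lra.
  assert (0 <= df s) by (apply H; lra); nra.
Qed.

Lemma derive_le (f df : R -> R) K t : 0 <= t ->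
  (forall s, 0 <= s <= t -> is_derive f s (df s) /\ df s <= K) ->
  f t <= f 0 + K * t.
Proof.
intros Ht H.
assert (M := derive_nonneg_le (fun s => K * s - f s) (fun s => K - df s) 0 t Ht).
cbv beta in M; rewrite Rmult_0_r in M.
enough (0 - f 0 <= K * t - f t) by lra; apply M.
intros s Hs; destruct (H s Hs) as [Hd Hle]; split; [|lra].
auto_derive; [eexists; exact Hd|].
change (fun x => f x) with f; rewrite (is_derive_unique _ _ _ Hd); ring.
Qed.

(** * Self-concordant functions of one variable *)

Section OneDim.
Variables (f f1 h h1 : R -> R) (T : R).
Hypothesis Hf : forall t, 0 <= t < T -> is_derive f t (f1 t).
Hypothesis Hf1 : forall t, 0 <= t < T -> is_derive f1 t (h t).
Hypothesis Hh : forall t, 0 <= t < T -> is_derive h t (h1 t).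
Hypothesis Hpos : forall t, 0 <= t < T -> 0 < h t.
Hypothesis Hsc : forall t, 0 <= t < T ->
  Rabs (h1 t) <= 2 * sqrt (h t) * sqrt (h t) * sqrt (h t).

(** The derivative of [h ^ (-1/2)] is [- h' / (2 h ^ (3/2))], and [Hsc] bounds exactly this quotient
    by 1. *)
Lemma self_concordant_lipschitz t : 0 <= t < T ->
  Rabs (/ sqrt (h t) - / sqrt (h 0)) <= t.
Proof.
intros Ht.
assert (Hd : forall s, 0 <= s <= t ->
  is_derive (fun s => / sqrt (h s)) s (- h1 s / (2 * sqrt (h s) * h s)) /\
  Rabs (- h1 s / (2 * sqrt (h s) * h s)) <= 1).
{ intros s Hs; assert (P := Hpos s ltac:(lra)).
  assert (Q := sqrt_lt_R0 _ P); assert (Q2 := sqrt_sqrt (h s) ltac:(lra)).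
  split.
  - assert (Hs' := Hh s ltac:(lra)).
    auto_derive; [split; [eexists; exact Hs'|]; split; [exact P|]; split; [lra | exact I]|].
    change (fun x => h x) with h; rewrite (is_derive_unique _ _ _ Hs').
    set (q := sqrt (h s)) in *; rewrite <- Q2; field; lra.
  - assert (S := Hsc s ltac:(lra)).
    set (q := sqrt (h s)) in *; rewrite <- Q2.
    assert (0 < 2 * q * (q * q)) by (apply Rmult_lt_0_compat; nra).
    unfold Rdiv; rewrite Rabs_mult, Rabs_Ropp, (Rabs_right (/ _)).
    2: apply Rle_ge; left; now apply Rinv_0_lt_compat.
    apply Rle_div_l; lra. }
set (phi := fun s => / sqrt (h s)) in *.
assert (A := derive_le phi (fun s => - h1 s / (2 * sqrt (h s) * h s)) 1 t ltac:(lra)).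
assert (B := derive_le (fun s => - phi s) (fun s => - (- h1 s / (2 * sqrt (h s) * h s))) 1 t ltac:(lra)).
apply Rabs_le; unfold phi in *; split.
- enough (- / sqrt (h t) <= - / sqrt (h 0) + 1 * t) by lra; apply B.
  intros s Hs; destruct (Hd s Hs) as [D1 D2]; split.
  + apply (is_derive_opp (K := R_AbsRing) (V := R_NormedModule) _ _ _ D1).
  + apply Rabs_le_between in D2; lra.
- enough (/ sqrt (h t) <= / sqrt (h 0) + 1 * t) by lra; apply A.
  intros s Hs; destruct (Hd s Hs) as [D1 D2]; split; [exact D1|].
  apply Rabs_le_between in D2; lra.
Qed.

(** The Lipschitz bound keeps [/ sqrt h] above [/ sqrt (h 0) - T > 0] on the whole interval, so [h]
    is bounded there, and two integrations bound [f]. *)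
Lemma self_concordant_bounded : 0 < T -> T ^ 2 * h 0 < 1 ->
  exists M, forall t, 0 <= t < T -> f t <= M.
Proof.
intros HT H0.
assert (P := Hpos 0 ltac:(lra)); assert (Q := sqrt_lt_R0 _ P).
assert (Q2 := sqrt_sqrt (h 0) ltac:(lra)).
set (a := sqrt (h 0)) in *.
assert (HaT : T * a < 1) by nra.
set (eps := / a - T).
assert (He : 0 < eps).
{ unfold eps; replace (/ a - T) with ((1 - T * a) / a) by (field; lra).
  apply Rdiv_lt_0_compat; lra. }
assert (HK : forall t, 0 <= t < T -> h t <= / eps ^ 2).
{ intros t Ht; assert (L := self_concordant_lipschitz t Ht); fold a in L.
  apply Rabs_le_between in L.
  assert (Pt := Hpos t Ht); assert (Qt := sqrt_lt_R0 _ Pt).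
  assert (Qt2 := sqrt_sqrt (h t) ltac:(lra)).
  assert (E : eps <= / sqrt (h t)) by (unfold eps; lra).
  apply (Rmult_le_compat_l (sqrt (h t))) in E; [|lra].
  rewrite Rinv_r in E by lra.
  apply (Rmult_le_reg_r (eps ^ 2)); [nra|].
  rewrite Rinv_l by nra; rewrite <- Qt2.
  assert (0 <= sqrt (h t) * eps) by nra; nra. }
set (K := / eps ^ 2) in *.
assert (HK0 : 0 < K) by (apply Rinv_0_lt_compat; nra).
assert (HK1 : forall t, 0 <= t < T -> f1 t <= Rabs (f1 0) + K * T).
{ intros t Ht.
  assert (M := derive_le f1 h K t ltac:(lra)).
  apply Rle_trans with (f1 0 + K * t).
  - apply M; intros s Hs; split; [apply Hf1; lra | apply HK; lra].
  - assert (R := Rle_abs (f1 0)); nra. }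
set (K1 := Rabs (f1 0) + K * T) in *.
assert (HK1p : 0 <= K1) by (assert (R := Rabs_pos (f1 0)); unfold K1; nra).
exists (f 0 + K1 * T); intros t Ht.
apply Rle_trans with (f 0 + K1 * t); [|nra].
apply (derive_le f f1); [lra|].
intros s Hs; split; [apply Hf; lra | apply HK1; lra].
Qed.

Variable theta : R.
Hypothesis Htheta : 0 <= theta.
Hypothesis Hbar : forall t, 0 <= t < T -> f1 t <= sqrt theta * sqrt (h t).

Lemma barrier_length : 0 < T -> 0 <= f1 0 -> T * sqrt (h 0) <= 1 + 2 * theta.
Proof.
intros HT H0.
assert (P := Hpos 0 ltac:(lra)); assert (Q := sqrt_lt_R0 _ P).
assert (Q2 := sqrt_sqrt (h 0) ltac:(lra)).
set (a := sqrt (h 0)) in *.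
(* The bound is immediate from [0 <= theta] when [T * a <= 1]; otherwise the time [/ a] used below
   lies before [T]. *)
destruct (Rle_dec (T * a) 1) as [|Hn]; [lra|].
apply Rnot_le_lt in Hn.
assert (Hlow : forall t, 0 <= t < T -> (a / (1 + a * t)) ^ 2 <= h t).
{ intros t Ht; assert (L := self_concordant_lipschitz t Ht); fold a in L.
  apply Rabs_le_between in L.
  assert (Pt := Hpos t Ht); assert (Qt := sqrt_lt_R0 _ Pt).
  assert (Qt2 := sqrt_sqrt (h t) ltac:(lra)).
  assert (Ea : 0 < 1 + a * t) by nra.
  assert (E : / sqrt (h t) <= (1 + a * t) / a).
  { replace ((1 + a * t) / a) with (/ a + t) by (field; lra); lra. }
  assert (E' : a / (1 + a * t) <= sqrt (h t)).
  { apply Rinv_le_contravar in E; [|now apply Rinv_0_lt_compat].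
    rewrite Rinv_inv in E; replace (a / (1 + a * t)) with (/ ((1 + a * t) / a)); [lra|].
    field; lra. }
  assert (0 <= a / (1 + a * t)) by (apply Rdiv_le_0_compat; lra).
  rewrite <- Qt2; nra. }
set (t0 := / a).
assert (Ht0 : 0 < t0) by now apply Rinv_0_lt_compat.
assert (Ha0 : a * t0 = 1) by (apply Rinv_r; lra).
assert (Ht0T : t0 < T) by nra.
(* [a * (1 - / (1 + a * s))] is the antiderivative of the lower bound in [Hlow] that vanishes at 0;
   its value at [s = / a] is [a / 2]. *)
assert (Hf0 : a / 2 <= f1 t0).
{ assert (M := derive_nonneg_le (fun s => f1 s - a * (1 - / (1 + a * s)))
    (fun s => h s - (a / (1 + a * s)) ^ 2) 0 t0 ltac:(lra)).
  cbv beta in M.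
  rewrite Rmult_0_r, Ha0 in M.
  enough (f1 0 - a * (1 - / (1 + 0)) <= f1 t0 - a * (1 - / (1 + 1))) as N.
  { replace (a * (1 - / (1 + 0))) with 0 in N by field.
    replace (a * (1 - / (1 + 1))) with (a / 2) in N by field; lra. }
  apply M; intros s Hs.
  assert (Es : 0 < 1 + a * s) by nra.
  assert (Hs' := Hf1 s ltac:(lra)).
  split; [|assert (L := Hlow s ltac:(lra)); lra].
  auto_derive; [split; [eexists; exact Hs'|]; split; [lra | exact I]|].
  change (fun x => f1 x) with f1; rewrite (is_derive_unique _ _ _ Hs'); field; lra. }
assert (Hge : forall t, t0 <= t < T -> a / 2 <= f1 t).
{ intros t Ht; apply Rle_trans with (1 := Hf0).
  apply (derive_nonneg_le f1 h); [lra|].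
  intros s Hs; split; [apply Hf1; lra | left; apply Hpos; lra]. }
assert (Hth : forall t, t0 <= t < T -> f1 t ^ 2 <= theta * h t).
{ intros t Ht; assert (B := Hbar t ltac:(lra)); assert (G := Hge t Ht).
  assert (Qt2 := sqrt_sqrt (h t) ltac:(left; apply Hpos; lra)).
  assert (Qth := sqrt_sqrt theta Htheta).
  rewrite <- Qt2, <- Qth.
  replace (sqrt theta * sqrt theta * (sqrt (h t) * sqrt (h t)))
    with ((sqrt theta * sqrt (h t)) ^ 2) by ring; nra. }
assert (Hend : forall t, t0 <= t < T -> a * (t - t0) <= 2 * theta).
(* The term [- theta / f1] starts no lower than [- 2 * theta / a], as [f1 t0 >= a / 2], and never
   exceeds 0; monotonicity therefore leaves at most [2 * theta / a] for [t - t0]. *)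
{ intros t Ht.
  assert (M := derive_nonneg_le (fun s => - theta / f1 s - s)
    (fun s => theta * h s / f1 s ^ 2 - 1) t0 t ltac:(lra)).
  enough (N : - theta / f1 t0 - t0 <= - theta / f1 t - t).
  { assert (G := Hge t Ht); assert (0 <= theta / f1 t) by (apply Rdiv_le_0_compat; lra).
    assert (theta / f1 t0 <= theta * (2 / a)).
    { apply Rmult_le_compat_l; [exact Htheta|].
      replace (2 / a) with (/ (a / 2)) by (field; lra).
      apply Rinv_le_contravar; lra. }
    assert (Ett : t - t0 <= theta * (2 / a)) by (unfold Rdiv in *; lra).
    apply (Rmult_le_compat_l a) in Ett; [|lra].
    replace (a * (theta * (2 / a))) with (2 * theta) in Ett by (field; lra); lra. }
  apply M; intros s Hs; assert (G := Hge s ltac:(lra)); split.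
  - assert (Hs' := Hf1 s ltac:(lra)).
    auto_derive; [split; [eexists; exact Hs'|]; split; [lra | exact I]|].
    change (fun x => f1 x) with f1; rewrite (is_derive_unique _ _ _ Hs'); field; lra.
  - assert (K := Hth s ltac:(lra)).
    enough (1 <= theta * h s / f1 s ^ 2) by lra.
    apply Rle_div_r; nra. }
apply Rnot_lt_le; intros Hlt.
(* [Hend] holds for times strictly below [T], so it is contradicted at the midpoint of
   [(1 + 2 * theta) / a] and [T]. *)
assert (Htt : t0 < (1 + 2 * theta) / a + (T - (1 + 2 * theta) / a) / 2 < T).
{ assert ((1 + 2 * theta) / a < T) by (apply Rlt_div_l; lra).
  assert (t0 <= (1 + 2 * theta) / a).
  { apply Rle_div_r; [lra|]; rewrite Rmult_comm, Ha0; lra. }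
  lra. }
assert (E := Hend _ (conj (Rlt_le _ _ (proj1 Htt)) (proj2 Htt))).
assert (E2 : a * ((1 + 2 * theta) / a + (T - (1 + 2 * theta) / a) / 2) = 
  (1 + 2 * theta) + (T * a - (1 + 2 * theta)) / 2) by (field; lra).
rewrite Rmult_minus_distr_l, Ha0 in E; lra.
Qed.

End OneDim.

(** * Choice of a vertex *)

Lemma geodesic_locally c t (Q : R * R -> Prop) : geodesic c ->
  locally (c t) Q -> locally t (fun s => Q (c s)).
Proof.
intros H [eps HQ].
destruct (geodesic_derives c H t) as [_ [Hx [Hy _]]].
assert (Cx := ex_derive_continuous _ _ (ex_intro _ _ Hx)).
assert (Cy := ex_derive_continuous _ _ (ex_intro _ _ Hy)).
assert (Bx : locally t (fun s => ball (fst (c t)) eps (fst (c s))))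
  by exact (Cx (ball (fst (c t)) eps) (locally_ball _ eps)).
assert (By : locally t (fun s => ball (snd (c t)) eps (snd (c s))))
  by exact (Cy (ball (snd (c t)) eps) (locally_ball _ eps)).
generalize (filter_and _ _ Bx By).
apply filter_imp; intros s [H1 H2]; apply HQ; split; assumption.
Qed.

(** * Barriers restricted to a geodesic *)

Section Barrier.
Variables (D : R * R -> Prop) (F : R * R -> R) (theta : R) (c : R -> R * R).
Hypothesis Dopen : forall p, D p -> locally p D.
Hypothesis Dhalf : forall p, D p -> half_plane p.
Hypothesis HF : barrier D F theta.
Hypothesis Hc : geodesic c.
Hypothesis Hspeed : 0 < speed2 c 0.

(** [T] is the supremum of the times up to which the curve stays in [D]. Openness puts [c T] outside
    [D], since otherwise the curve would stay inside a little longer. *)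
Lemma exit_time t1 : D (c 0) -> 0 <= t1 -> ~ D (c t1) ->
  exists T, 0 < T <= t1 /\ (forall t, 0 <= t < T -> D (c t)) /\ ~ D (c T).
Proof.
intros H0 Ht1 Hn.
set (E := fun t => 0 <= t <= t1 /\ forall s, 0 <= s <= t -> D (c s)).
destruct (completeness E) as [T [Hub Hlub]].
- exists t1; intros t [Ht _]; lra.
- exists 0; split; [lra|]; intros s Hs; replace s with 0 by lra; exact H0.
- assert (HT0 : 0 <= T).
  { apply Hub; split; [lra|]; intros s Hs; replace s with 0 by lra; exact H0. }
  assert (HT1 : T <= t1) by (apply Hlub; intros t [Ht _]; lra).
  assert (HD : forall t, 0 <= t < T -> D (c t)).
  { intros t Ht; destruct (Classical_Prop.classic (D (c t))) as [|N]; [assumption|].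
    exfalso; assert (T <= t); [|lra].
    apply Hlub; intros s [Hs HsD]; apply Rnot_lt_le; intros Hts.
    apply N, HsD; lra. }
  assert (HTn : ~ D (c T)).
  { intros HTD; destruct (geodesic_locally c T D Hc (Dopen _ HTD)) as [eps He].
    destruct (Req_dec T t1) as [-> | Hneq]; [auto|].
    set (t' := Rmin t1 (T + eps / 2)).
    assert (He0 := cond_pos eps).
    assert (Ht' : T < t' /\ t' <= t1 /\ t' <= T + eps / 2).
    { unfold t'; split; [apply Rmin_glb_lt; lra|]; split; [apply Rmin_l | apply Rmin_r]. }
    enough (t' <= T) by lra; apply Hub; split; [lra|].
    intros s Hs; destruct (Rlt_le_dec s T); [apply HD; lra|].
    apply He; unfold ball; simpl; unfold AbsRing_ball; simpl; unfold abs, minus, plus, opp; simpl.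
    apply Rabs_lt_between; lra. }
  exists T; split; [|split; auto].
  split; [|exact HT1].
  destruct HT0 as [|<-]; [assumption | now elim HTn].
Qed.

Lemma velocity_neq0 t : velocity c t <> (0, 0).
Proof.
intros E; assert (S := speed2_const c Hc t).
rewrite speed2E, E in S by apply Hc; simpl in S.
unfold Rdiv in S; ring_simplify in S; lra.
Qed.

Lemma barrier_hess_pos t : D (c t) -> 0 < hess F (c t) (velocity c t) (velocity c t).
Proof. intros Ht; apply HF; [exact Ht | apply velocity_neq0]. Qed.

Lemma barrier_third_le t : D (c t) ->
  let q := sqrt (hess F (c t) (velocity c t) (velocity c t)) in
  Rabs (third F (c t) (velocity c t) (velocity c t) (velocity c t)) <= 2 * q * q * q.
Proof. intros Ht; now apply HF. Qed.

Lemma barrier_smooth : Ck 3 D F.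
Proof. apply HF. Qed.

(** Otherwise [F] stays bounded up to the exit time and the closed epigraph
    would contain a point above the boundary of [D]. *)
Lemma dikin_exit t1 : D (c 0) -> 0 <= t1 -> ~ D (c t1) ->
  1 <= t1 ^ 2 * hess F (c 0) (velocity c 0) (velocity c 0).
Proof.
intros H0 Ht1 Hn.
destruct (exit_time t1 H0 Ht1 Hn) as [T [HT [HD HTn]]].
apply Rnot_lt_le; intros Hlt.
assert (HC := barrier_smooth).
destruct (self_concordant_bounded _ _ _ _ T
  (fun t Ht => derive_along0 D F c t Dopen HC Hc (HD t Ht))
  (fun t Ht => derive_along1 D F c t Dopen Dhalf HC Hc (HD t Ht))
  (fun t Ht => derive_along2 D F c t Dopen Dhalf HC Hc (HD t Ht))
  (fun t Ht => barrier_hess_pos t (HD t Ht))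
  (fun t Ht => barrier_third_le t (HD t Ht))) as [M HM].
- lra.
- assert (Hp := barrier_hess_pos 0 H0).
  set (h := hess _ _ _ _) in *; cbv beta.
  apply Rle_lt_trans with (t1 ^ 2 * h); [|exact Hlt].
  apply Rmult_le_compat_r; [lra|]; apply pow_incr; lra.
- apply HTn.
  destruct HF as [_ [_ [[_ Hcl] _]]].
  apply (Hcl (c T, M)); [apply Hc|].
  intros [eps Heps].
  destruct (geodesic_locally c T (ball (c T) eps) Hc (locally_ball _ _)) as [del Hdel].
  set (t := Rmax (T / 2) (T - del / 2)).
  assert (Hd0 := cond_pos del).
  assert (Ht : T / 2 <= t /\ T - del / 2 <= t /\ t < T).
  { unfold t; split; [apply Rmax_l|]; split; [apply Rmax_r|]; apply Rmax_lub_lt; lra. }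
  apply (Heps (c t, M)).
  + split; [|apply ball_center].
    apply Hdel; unfold ball; simpl; unfold AbsRing_ball; simpl; unfold abs, minus, plus, opp; simpl.
    apply Rabs_lt_between; lra.
  + split; simpl; [apply HD; lra | apply HM; lra].
Qed.

Lemma barrier_ray T : (forall t, 0 <= t < T -> D (c t)) -> 0 < T ->
  0 <= dir_derive F (c 0) (velocity c 0) ->
  T * sqrt (hess F (c 0) (velocity c 0) (velocity c 0)) <= 1 + 2 * theta.
Proof.
intros HD HT H0.
assert (HC := barrier_smooth).
refine (barrier_length _ _ _ T
  (fun t Ht => derive_along1 D F c t Dopen Dhalf HC Hc (HD t Ht))
  (fun t Ht => derive_along2 D F c t Dopen Dhalf HC Hc (HD t Ht))
  (fun t Ht => barrier_hess_pos t (HD t Ht))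
  (fun t Ht => barrier_third_le t (HD t Ht)) theta _ _ HT H0).
- apply HF.
- intros t Ht; rewrite <- inner_grad by apply Hc.
  assert (Hp := sqrt_lt_R0 _ (barrier_hess_pos t (HD t Ht))).
  apply Rle_div_l; [exact Hp|].
  apply HF; [now apply HD | apply velocity_neq0].
Qed.

End Barrier.

Lemma sum_neg (f : nat -> R) N : (forall k, (k <= N)%nat -> f k < 0) ->
  sum_f_R0 f N < 0.
Proof.
induction N as [|N IH]; intros H; simpl; [apply H; lia|].
assert (sum_f_R0 f N < 0) by (apply IH; intros; apply H; lia).
assert (f (S N) < 0) by (apply H; lia); lra.
Qed.

(** * Vertex directions with large Hessian and nonnegative slope *)

Section Selection.
Variables (n : nat) (e : R * R) (l : R) (Q : R * R -> R) (G : R * R -> R).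
Variables q1 q2 q3 g1 g2 : R.
Hypothesis hn : (3 <= n)%nat.
Hypothesis He : fst e ^ 2 + snd e ^ 2 = 1.
Hypothesis HQ : forall x y, Q (x, y) = q1 * x ^ 2 + q2 * (x * y) + q3 * y ^ 2.
Hypothesis HQpos : forall m, 0 <= Q m.
Hypothesis HG : forall x y, G (x, y) = g1 * x + g2 * y.
Hypothesis Hexit : forall m, fst m ^ 2 + snd m ^ 2 = 1 ->
  (forall k, fst m * fst (unit_vertex n e k) + snd m * snd (unit_vertex n e k)
     <= cos (PI / INR n)) -> 1 <= l ^ 2 * Q m.

Lemma unit_vertex_dot b k :
  fst (rotate b e) * fst (unit_vertex n e k) + snd (rotate b e) * snd (unit_vertex n e k)
  = cos (INR k * step n - b).
Proof.
unfold unit_vertex, rotate; simpl fst; simpl snd; rewrite cos_minus.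
transitivity ((cos (INR k * step n) * cos b + sin (INR k * step n) * sin b)
  * (fst e ^ 2 + snd e ^ 2)); [ring | rewrite He; ring].
Qed.

Lemma rotate_norm b : fst (rotate b e) ^ 2 + snd (rotate b e) ^ 2 = 1.
Proof.
assert (T := sin2_cos2 b); unfold Rsqr in T; unfold rotate; simpl fst; simpl snd.
transitivity ((fst e ^ 2 + snd e ^ 2) * (sin b * sin b + cos b * cos b)); [ring|].
rewrite T, He; ring.
Qed.

(** The vertex directions sum to zero, hence so do the values of the linear form [G], and they
    cannot all be negative. *)
Lemma exists_ascent_vertex : exists j, (j < n)%nat /\ 0 <= G (unit_vertex n e j).
Proof.
destruct (Classical_Prop.classic (exists j, (j < n)%nat /\ 0 <= G (unit_vertex n e j)))
  as [|N]; [assumption|exfalso].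
assert (S : sum_f_R0 (fun k => G (unit_vertex n e k)) (pred n) = 0).
{ rewrite (sum_quadratic_trig n hn 0 (g1 * fst e + g2 * snd e)
    (g2 * fst e - g1 * snd e) 0 0 0); [field|].
  intros k c s; unfold unit_vertex, rotate; fold c s; rewrite HG; ring. }
assert (S' : sum_f_R0 (fun k => G (unit_vertex n e k)) (pred n) < 0); [|lra].
apply sum_neg; intros k Hk; apply Rnot_le_lt; intros Hk'.
apply N; exists k; split; [lia | exact Hk'].
Qed.

Lemma select_odd h : n = (2 * h + 1)%nat ->
  exists j, 0 <= G (unit_vertex n e j) /\ 1 <= 4 * l ^ 2 * Q (unit_vertex n e j).
Proof.
intros Eh; destruct exists_ascent_vertex as [j [Hj HGj]].
exists j; split; [exact HGj|].
assert (Hn := INR_n_ge3 n hn).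
set (b := INR j * step n - PI).
assert (Hneg : Q (unit_vertex n e j) = Q (rotate b e)).
{ unfold unit_vertex, rotate, b; rewrite !HQ.
  rewrite cos_minus, sin_minus, cos_PI, sin_PI; ring. }
rewrite Hneg; assert (P := HQpos (rotate b e)).
enough (1 <= l ^ 2 * Q (rotate b e)) by lra.
apply Hexit; [apply rotate_norm|].
intros k; rewrite unit_vertex_dot.
(* For [n = 2 h + 1] the angle [(k - j) * step n + PI] is the odd multiple [2 (k + h + 1 - j) - 1]
   of [PI / n]. Adding [n] to the index costs one full turn and, as [j < n], keeps the subtraction
   on [nat] from truncating. *)
eapply Rle_trans; [right | apply (cos_odd_multiple n hn (k + n + h + 1 - j))].
rewrite minus_INR by lia; rewrite !plus_INR.
assert (En : INR n = 2 * INR h + 1) by (rewrite Eh, plus_INR, mult_INR; simpl; ring).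
replace (2 * (INR k + INR n + INR h + INR 1 - INR j) - 1)
  with (2 * (INR k - INR j) + 3 * INR n) by (rewrite En; simpl; ring).
unfold b, step.
replace ((2 * (INR k - INR j) + 3 * INR n) * (PI / INR n)) with
  ((INR k * (2 * PI / INR n) - (INR j * (2 * PI / INR n) - PI)) + 2 * INR 1 * PI)
  by (simpl; field; lra).
now rewrite cos_period.
Qed.

Lemma select_even h : n = (2 * h)%nat ->
  exists j, 0 <= G (unit_vertex n e j) /\ 1 <= 4 * l ^ 2 * Q (unit_vertex n e j).
Proof.
intros Eh.
assert (Hn := INR_n_ge3 n hn); assert (HA := angle_bound n hn).
assert (HPI := PI_RGT_0).
set (x := PI / INR n) in *; set (m := rotate x e).
assert (Ex : step n = 2 * x) by (unfold step, x; field; lra).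
assert (Hm : 1 <= l ^ 2 * Q m).
{ apply Hexit; [apply rotate_norm|]; intros k; unfold m.
  rewrite unit_vertex_dot, Ex.
  replace (INR k * (2 * x) - x) with ((2 * INR k - 1) * x) by ring.
  apply cos_odd_multiple, hn. }
assert (Hcos : 1 / 2 <= cos x).
{ rewrite <- cos_PI3; apply cos_decr_1; lra. }
(* The parallelogram identity for [Q]: the sum of the two adjacent directions is [2 cos x] times
   their bisector [m], and their difference is [2 sin x] times a vector orthogonal to [m]. As
   [2 cos x >= 1], the larger of the two values is at least [Q m / 4], the source of the factor 4 in
   the conclusion. *)
assert (Hsum : 2 * (Q (unit_vertex n e 0) + Q (unit_vertex n e 1)) =
  4 * cos x ^ 2 * Q m + Q (2 * sin x * snd m, - 2 * sin x * fst m)).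
{ unfold m, unit_vertex, rotate; simpl fst; simpl snd; rewrite !HQ.
  rewrite Ex; simpl INR; rewrite Rmult_0_l, Rmult_1_l, cos_0, sin_0.
  rewrite sin_2a, cos_2a; set (c := cos x); set (s := sin x).
  assert (T := sin2_cos2 x); unfold Rsqr in T; fold c s in T.
  assert (T2 : c * c = 1 - s * s) by lra.
  (* The factor [(s * s + c * c) ^ 2] makes both sides homogeneous of degree 4 in [c] and [s], so
     that [ring] can compare them. *)
  transitivity (2 * ((q1 * (1 * fst e - 0 * snd e) ^ 2 + q2 * ((1 * fst e - 0 * snd e) * (0 * fst e + 1 * snd e)) + q3 * (0 * fst e + 1 * snd e) ^ 2) * (s * s + c * c) ^ 2 +
    (q1 * ((c * c - s * s) * fst e - 2 * s * c * snd e) ^ 2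
    + q2 * (((c * c - s * s) * fst e - 2 * s * c * snd e) * (2 * s * c * fst e + (c * c - s * s) * snd e))
    + q3 * (2 * s * c * fst e + (c * c - s * s) * snd e) ^ 2))).
  - rewrite T; ring.
  - ring. }
assert (Hd := HQpos (2 * sin x * snd m, - 2 * sin x * fst m)).
assert (Hmp : Q m <= 4 * cos x ^ 2 * Q m).
{ assert (Hc2 : 1 <= 4 * cos x ^ 2) by nra.
  apply (Rmult_le_compat_r (Q m)) in Hc2; [lra | apply HQpos]. }
assert (Hi : exists i, 1 <= 4 * l ^ 2 * Q (unit_vertex n e i)).
{ destruct (Rle_dec (Q (unit_vertex n e 0)) (Q (unit_vertex n e 1))).
  - exists 1%nat.
    assert (Hq : Q m <= 4 * Q (unit_vertex n e 1)) by lra.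
    apply (Rmult_le_compat_l (l ^ 2)) in Hq; [lra | apply pow2_ge_0].
  - exists 0%nat.
    assert (Hq : Q m <= 4 * Q (unit_vertex n e 0)) by lra.
    apply (Rmult_le_compat_l (l ^ 2)) in Hq; [lra | apply pow2_ge_0]. }
destruct Hi as [i Hi].
(* For even [n] the opposite of a vertex direction is again one: [Q] keeps its value and [G] changes
   sign, so one of the two has nonnegative slope. *)
assert (Hopp : unit_vertex n e (i + h) =
  (- fst (unit_vertex n e i), - snd (unit_vertex n e i))).
{ unfold unit_vertex; rewrite plus_INR, Rmult_plus_distr_r.
  replace (INR h * step n) with PI.
  - unfold rotate; rewrite neg_sin, neg_cos; simpl; f_equal; ring.
  - assert (En : INR n = 2 * INR h) by (rewrite Eh, mult_INR; simpl; ring).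
    unfold step; rewrite En; field; lra. }
destruct (Rle_dec 0 (G (unit_vertex n e i))) as [Hg|Hg].
- exists i; auto.
- exists (i + h)%nat; rewrite Hopp, HG, HQ.
  revert Hg Hi; rewrite (surjective_pairing (unit_vertex n e i)); rewrite HG, HQ.
  simpl fst; simpl snd; intros Hg Hi; split; [lra|].
  eapply Rle_trans; [exact Hi|]; right; ring.
Qed.

Lemma select_vertex :
  exists j, 0 <= G (unit_vertex n e j) /\ 1 <= 4 * l ^ 2 * Q (unit_vertex n e j).
Proof.
destruct (Nat.Even_or_Odd n) as [[h E] | [h E]].
- now apply (select_even h).
- now apply (select_odd h).
Qed.

End Selection.

Theorem theoremA1 (n : nat) (L theta : R) (P : R * R -> Prop) (F : R * R -> R)
    (hn : (3 <= n)%nat) (hL : 0 < L)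
    (hP : regular_polygon n L P)
    (hF : barrier (h_interior P) F theta) :
  theta >= L / (32 * ln (INR n)) - 1 / 8.
Proof.
destruct (regular_polygon_frame n L P hn hL hP) as [o [e [r [v [Hf [HLr HP]]]]]].
set (D := h_interior P) in *.
assert (Dopen : forall p, D p -> locally p D) by (intros p; apply locally_locally).
assert (DP : forall p, D p <->
  h_interior (g_hull (fun w => exists k, w = v k)) p).
{ intros p; unfold D, h_interior; split; apply filter_imp; intros q; apply HP. }
assert (Dhalf : forall p, D p -> half_plane p).
{ intros p Hp; apply locally_singleton, HP in Hp; revert Hp.
  apply g_hull_half_plane, (vertices_half_plane n o e r v Hf). }
assert (Ho : half_plane o) by apply Hf.
assert (Hr : 0 < r) by apply Hf.
assert (He : fst e ^ 2 + snd e ^ 2 = 1) by apply Hf.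
assert (Hn := INR_n_ge3 n hn).
set (l := ln (INR n)).
assert (Hl : 0 < l) by (unfold l; rewrite <- ln_1; apply ln_increasing; lra).
assert (Hb : 0 < snd o) by exact Ho.
assert (HDo : D o).
{ apply DP; destruct (ray_spec o _ Ho (unit_vertex_norm n o e r v Hf 0)) as [_ [_ [E _]]].
  rewrite <- E; apply (vertex_ray_interior n o e r v hn Hf); lra. }
(* The metric at [o] is the Euclidean one divided by [snd o ^ 2], so [w] sends Euclidean unit
   vectors to unit tangent vectors at [o]. *)
set (w := fun m : R * R => (snd o * fst m, snd o * snd m)).
assert (Hray : forall m, fst m ^ 2 + snd m ^ 2 = 1 -> geodesic (ray o m) /\
  0 < speed2 (ray o m) 0 /\ ray o m 0 = o /\ velocity (ray o m) 0 = w m).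
{ intros m Hm; destruct (ray_spec o m Ho Hm) as [R1 [R2 [R3 R4]]].
  split; [exact R1|]; split; [rewrite R2; lra|]; split; [exact R3 | exact R4]. }
assert (Hpos : forall m, 0 <= hess F o (w m) (w m)).
{ intros m; destruct (Classical_Prop.classic (w m = (0, 0))) as [-> | N].
  - right; unfold hess, sum2, coord; simpl; ring.
  - left; now apply hF. }
destruct (select_vertex n e l (fun m => hess F o (w m) (w m))
  (fun m => dir_derive F o (w m))
  (hess_coef F i1 i1 o * snd o ^ 2)
  ((hess_coef F i1 i2 o + hess_coef F i2 i1 o) * snd o ^ 2)
  (hess_coef F i2 i2 o * snd o ^ 2)
  (pd i1 F o * snd o) (pd i2 F o * snd o) hn He) as [j [Hj1 Hj2]].
- intros x y; unfold hess, sum2, coord, w; simpl; ring.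
- exact Hpos.
- intros x y; unfold dir_derive, w; simpl; ring.
- intros m Hm Hk; destruct (Hray m Hm) as [R1 [R2 [R3 R4]]].
  assert (K := dikin_exit D F theta _ Dopen Dhalf hF R1 R2 l).
  rewrite R3, R4 in K; apply K; [exact HDo | lra |].
  rewrite DP; apply (ray_exit n o e r v hn Hf m l Hm Hk), ln_exit, hn.
- set (m := unit_vertex n e j) in *.
  destruct (Hray m (unit_vertex_norm n o e r v Hf j)) as [R1 [R2 [R3 R4]]].
  assert (K := barrier_ray D F theta _ Dopen Dhalf hF R1 R2 r).
  rewrite R3, R4 in K.
  assert (B : r * sqrt (hess F o (w m) (w m)) <= 1 + 2 * theta).
  { apply K; auto.
    intros t Ht; apply DP, (vertex_ray_interior n o e r v hn Hf j t Ht). }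
  assert (Hs := sqrt_sqrt _ (Hpos m)); assert (Hs0 := sqrt_pos (hess F o (w m) (w m))).
  set (s := sqrt _) in *.
  assert (Hls : 1 <= 2 * l * s).
  { apply Rnot_lt_le; intros Hlt; rewrite <- Hs in Hj2.
    assert (0 <= 2 * l * s) by (apply Rmult_le_pos; lra).
    assert ((2 * l * s) * (2 * l * s) < 1) by nra; lra. }
  assert (Hth : 0 <= theta) by apply hF.
  assert (Hrl : r <= 2 * l * (1 + 2 * theta)) by nra.
  (* From [L <= 2 * r <= 4 * l * (1 + 2 * theta)] one gets [L / (32 * l) <= 1 / 8 + theta / 4], and
     [0 <= theta] finishes. *)
  apply Rle_ge; enough (L / (32 * l) <= theta + 1 / 8) by lra.
  apply Rle_div_l; [lra|]; nra.
Qed.
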